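(* Let $\mathbf r(t)$ be a non-planar rational parametric space curve defined on an interval $I$ and let $t_0\in I$ be a parameter that is not the right endpoint of $I$. Then there exists $t_1>t_0$, $t_1\in I$, such that the segment $\mathbf r(t)$, $t\in[t_0,t_1]$, is a quasi-cubic Bézier segment.
   Context: Setting: $\mathbf r(t)=(x(t),y(t),z(t))$ with $x,y,z$ rational functions with real coefficients whose denominators do not vanish on the parameter interval, properly parametrized, and not contained in a plane (curvature $\kappa$ and torsion $\tau$ not identically zero). Here $\kappa=\|\mathbf r'\times\mathbf r''\|/\|\mathbf r'\|^3$ and $\tau$ vanishes exactly where $\det(\mathbf r',\mathbf r'',\mathbf r''')=0$. Unit tangent $\boldsymbol\alpha=\mathbf r'/\|\mathbf r'\|$, unit binormal $\boldsymbol\gamma=\mathbf r'\times\mathbf r''/\|\mathbf r'\times\mathbf r''\|$; at any parameter $s$ one uses the one-sided limits $\boldsymbol\alpha^{\pm}(s)=\lim_{t\to s^\pm}\boldsymbol\alpha(t)$, $\boldsymbol\gamma^{\pm}(s)=\lim_{t\to s^\pm}\boldsymbol\gamma(t)$ (which exist for rational curves); tangent lines $T^{\pm}(s)=\{\mathbf r(s)+\lambda\boldsymbol\alpha^{\pm}(s)\}$, osculating planes $O^{\pm}(s)=\{X:(X-\mathbf r(s))\cdot\boldsymbol\gamma^{\pm}(s)=0\}$ (at ordinary points the $\pm$ versions coincide and are written $O(s)$, $T(s)$). A point is singular if it corresponds to more than one parameter counted with multiplicity. Associated tetrahedron of the segment $[t_0,t_1]$: $\mathbf r_0=\mathbf r(t_0)$,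 $\mathbf r_3=\mathbf r(t_1)$, $L=O^+(t_0)\cap O^-(t_1)$, $\mathbf r_1=T^+(t_0)\cap L$, $\mathbf r_2=T^-(t_1)\cap L$; the tetrahedron $\mathbf r_0\mathbf r_1\mathbf r_2\mathbf r_3$ (requires these intersections to exist and $\mathbf r_1\neq\mathbf r_2$). For $t_0\le a<b\le t_1$ the associated tetrahedron of $[a,b]$ is defined the same way. Parallel point: for a segment lying on one side of a plane $Q$ with both endpoints on $Q$, a point $\mathbf r(t)$, $t$ interior, with $\mathbf r'(t)$ parallel to $Q$. Quasi-cubic Bézier segment: a segment $\mathbf r(t)$, $t\in[t_0,t_1]$, whose associated tetrahedron $\mathbf r_0\mathbf r_1\mathbf r_2\mathbf r_3$ is non-degenerate and which has the following eight properties: (Q1) the one-sided tangent directions at $t_0$ and $t_1$ are parallel to $\mathbf r_0\mathbf r_1$ and $\mathbf r_2\mathbf r_3$; (Q2) the planes $\mathbf r_0\mathbf r_1\mathbf r_2$ and $\mathbf r_1\mathbf r_2\mathbf r_3$ are $O^+(t_0)$ and $O^-(t_1)$; (Q3) $\mathbf r([t_0,t_1])$ lies in the tetrahedron; (Q4) the segment has no singular points and $\kappa(t)\ne0$, $\tau(t)\ne0$ for $t\in(t_0,t_1)$; (Q5) for all $t_0\le a<b\le t_1$ the associated tetrahedron of $[a,b]$ lies in $\mathbf r_0\mathbf r_1\mathbf r_2\mathbf r_3$; (Q6) for $t^\star\in(t_0,t_1)$, $O(t^\star)$ meets the lines $\mathbf r_0\mathbf r_1,\mathbf r_1\mathbf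 r_2,\mathbf r_2\mathbf r_3$ at points $\mathbf r_{01},\mathbf r_{12},\mathbf r_{23}$ and $\|\mathbf r_0\mathbf r_{01}\|,\|\mathbf r_1\mathbf r_{12}\|,\|\mathbf r_2\mathbf r_{23}\|$ are strictly monotone in $t^\star$; (Q7) with $\mathbf r_{03}$ the intersection of the plane $\mathbf r_1\mathbf r_2\mathbf r(t^\star)$ with line $\mathbf r_0\mathbf r_3$ and $\mathbf r_{12}'$ the intersection of the plane $\mathbf r_0\mathbf r_3\mathbf r(t^\star)$ with line $\mathbf r_1\mathbf r_2$, $\|\mathbf r_0\mathbf r_{03}\|$ and $\|\mathbf r_1\mathbf r_{12}'\|$ are strictly monotone in $t^\star\in(t_0,t_1)$; (Q8) there is exactly one parallel point associated to the plane $\mathbf r_0\mathbf r_2\mathbf r_3$ and exactly one associated to the plane $\mathbf r_0\mathbf r_1\mathbf r_3$, and they are the points of the segment at maximal distance from these planes. *)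

(* Defs.v *)
From Stdlib Require Import Reals List.
Open Scope R_scope.

Record V3 := mkV { vx : R; vy : R; vz : R }.

Definition vadd (u v : V3) : V3 := mkV (vx u + vx v) (vy u + vy v) (vz u + vz v).
Definition vsub (u v : V3) : V3 := mkV (vx u - vx v) (vy u - vy v) (vz u - vz v).
Definition vscale (k : R) (u : V3) : V3 := mkV (k * vx u) (k * vy u) (k * vz u).
Definition vzero : V3 := mkV 0 0 0.
Definition dot (u v : V3) : R := vx u * vx v + vy u * vy v + vz u * vz v.
Definition cross (u v : V3) : V3 :=
  mkV (vy u * vz v - vz u * vy v) (vz u * vx v - vx u * vz v) (vx u * vy v - vy u * vx v).
Definition vnorm (u : V3) : R := sqrt (dot u u).
Definition det3 (u v w : V3) : R := dot u (cross v w).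

Fixpoint peval (p : list R) (x : R) : R :=
  match p with nil => 0 | a :: q => a + x * peval q x end.
Fixpoint padd (p q : list R) : list R :=
  match p, q with
  | nil, _ => q
  | _, nil => p
  | a :: p', b :: q' => (a + b) :: padd p' q'
  end.
Definition psub (p q : list R) : list R := padd p (map Ropp q).
Fixpoint pmul (p q : list R) : list R :=
  match p with
  | nil => nil
  | a :: p' => padd (map (Rmult a) q) (0 :: pmul p' q)
  end.
Fixpoint pderiv_aux (p : list R) (k : nat) : list R :=
  match p with nil => nil | a :: q => (INR k * a) :: pderiv_aux q (S k) end.
Definition pderiv (p : list R) : list R :=
  match p with nil => nil | _ :: q => pderiv_aux q 1 end.

Record ratf := mkRat { num : list R; den : list R }.
Definition reval (f : ratf) (t : R) : R := peval (num f) t / peval (den f) t.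
(* derivative by the quotient rule (equals the analytic derivative where den <> 0) *)
Definition rderiv (f : ratf) : ratf :=
  mkRat (psub (pmul (pderiv (num f)) (den f)) (pmul (num f) (pderiv (den f))))
        (pmul (den f) (den f)).

Record curve := mkCurve { cx : ratf; cy : ratf; cz : ratf }.
Definition cmap (g : ratf -> ratf) (c : curve) : curve := mkCurve (g (cx c)) (g (cy c)) (g (cz c)).

Definition pt (c : curve) (t : R) : V3 := mkV (reval (cx c) t) (reval (cy c) t) (reval (cz c) t).
Definition d1 (c : curve) : curve := cmap rderiv c.
Definition r1 (c : curve) (t : R) : V3 := pt (d1 c) t.
Definition r2 (c : curve) (t : R) : V3 := pt (d1 (d1 c)) t.
Definition r3 (c : curve) (t : R) : V3 := pt (d1 (d1 (d1 c))) t.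

Definition dens_nonzero (c : curve) (t : R) : Prop :=
  peval (den (cx c)) t <> 0 /\ peval (den (cy c)) t <> 0 /\ peval (den (cz c)) t <> 0.

Definition C : Type := (R * R)%type.
Definition Cadd (z w : C) : C := (fst z + fst w, snd z + snd w).
Definition Cmul (z w : C) : C := (fst z * fst w - snd z * snd w, fst z * snd w + snd z * fst w).
Definition RtoC (x : R) : C := (x, 0).
Fixpoint pevalC (p : list R) (z : C) : C :=
  match p with nil => (0, 0) | a :: q => Cadd (RtoC a) (Cmul z (pevalC q z)) end.
Definition dens_nonzeroC (c : curve) (z : C) : Prop :=
  pevalC (den (cx c)) z <> (0,0) /\ pevalC (den (cy c)) z <> (0,0) /\ pevalC (den (cz c)) z <> (0,0).
(* f(s) = f(t) for the rational function f, written with denominators cleared *)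
Definition same_valC (f : ratf) (s t : C) : Prop :=
  Cmul (pevalC (num f) s) (pevalC (den f) t) = Cmul (pevalC (num f) t) (pevalC (den f) s).
Definition same_ptC (c : curve) (s t : C) : Prop :=
  same_valC (cx c) s t /\ same_valC (cy c) s t /\ same_valC (cz c) s t.

(* Proper parametrization: almost every point of the (complexified) curve is
   generated by exactly one parameter value. *)
Definition proper (c : curve) : Prop :=
  exists E : list C, forall s t : C,
    ~ In t E -> dens_nonzeroC c s -> dens_nonzeroC c t -> same_ptC c s t -> s = t.

(* A point r(t) is singular if it corresponds to more than one parameter counted
   with multiplicity: another (complex) parameter gives the same point, or
   t itself is a multiple parameter (r'(t) = 0). *)
Definition singular (c : curve) (t : R) : Prop :=
  (exists s : C, s <> RtoC t /\ dens_nonzeroC c s /\ same_ptC c s (RtoC t))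
  \/ r1 c t = vzero.

Definition curvature (c : curve) (t : R) : R :=
  vnorm (cross (r1 c t) (r2 c t)) / (vnorm (r1 c t)) ^ 3.
Definition torsion (c : curve) (t : R) : R :=
  det3 (r1 c t) (r2 c t) (r3 c t) / (vnorm (cross (r1 c t) (r2 c t))) ^ 2.
Definition alpha (c : curve) (t : R) : V3 := vscale (/ vnorm (r1 c t)) (r1 c t).
Definition gamma (c : curve) (t : R) : V3 :=
  vscale (/ vnorm (cross (r1 c t) (r2 c t))) (cross (r1 c t) (r2 c t)).

Definition lim_right (f : R -> V3) (s : R) (L : V3) : Prop :=
  forall eps, eps > 0 -> exists del, del > 0 /\
    forall t, s < t < s + del -> vnorm (vsub (f t) L) < eps.
Definition lim_left (f : R -> V3) (s : R) (L : V3) : Prop :=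
  forall eps, eps > 0 -> exists del, del > 0 /\
    forall t, s - del < t < s -> vnorm (vsub (f t) L) < eps.

Definition on_line (P d X : V3) : Prop := exists lam : R, X = vadd P (vscale lam d).
Definition in_plane (P g X : V3) : Prop := dot (vsub X P) g = 0.
Definition in_plane3 (A B C' X : V3) : Prop := det3 (vsub B A) (vsub C' A) (vsub X A) = 0.
Definition parallel (u v : V3) : Prop := cross u v = vzero.
Definition in_tet (P0 P1 P2 P3 X : V3) : Prop :=
  exists l0 l1 l2 l3 : R, 0 <= l0 /\ 0 <= l1 /\ 0 <= l2 /\ 0 <= l3 /\
    l0 + l1 + l2 + l3 = 1 /\
    X = vadd (vadd (vscale l0 P0) (vscale l1 P1)) (vadd (vscale l2 P2) (vscale l3 P3)).
Definition nondegenerate (P0 P1 P2 P3 : V3) : Prop :=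
  det3 (vsub P1 P0) (vsub P2 P0) (vsub P3 P0) <> 0.

(* Associated tetrahedron P0 P1 P2 P3 of the segment [a,b]:
   P0 = r(a), P3 = r(b), L = O+(a) /\ O-(b) is a line,
   P1 = T+(a) /\ L, P2 = T-(b) /\ L (unique intersection points), P1 <> P2. *)
Definition assoc_tet (c : curve) (a b : R) (P0 P1 P2 P3 : V3) : Prop :=
  exists al gl ar gr : V3,
    lim_right (alpha c) a al /\ lim_right (gamma c) a gl /\
    lim_left (alpha c) b ar /\ lim_left (gamma c) b gr /\
    P0 = pt c a /\ P3 = pt c b /\
    cross gl gr <> vzero /\
    (on_line P0 al P1 /\ in_plane P0 gl P1 /\ in_plane P3 gr P1 /\
     forall X, on_line P0 al X -> in_plane P0 gl X -> in_plane P3 gr X -> X = P1) /\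
    (on_line P3 ar P2 /\ in_plane P0 gl P2 /\ in_plane P3 gr P2 /\
     forall X, on_line P3 ar X -> in_plane P0 gl X -> in_plane P3 gr X -> X = P2) /\
    P1 <> P2.

Definition strict_mono_on (a b : R) (g : R -> R) : Prop :=
  (forall x y, a < x -> x < y -> y < b -> g x < g y) \/
  (forall x y, a < x -> x < y -> y < b -> g y < g x).

Definition unique_meet (A B : V3) (Pl : V3 -> Prop) (X : V3) : Prop :=
  on_line A (vsub B A) X /\ Pl X /\
  forall Y, on_line A (vsub B A) Y -> Pl Y -> Y = X.

Definition osc (c : curve) (t : R) (X : V3) : Prop := in_plane (pt c t) (gamma c t) X.

Definition dist_plane (A n X : V3) : R := Rabs (dot n (vsub X A)) / vnorm n.

Definition parallel_dir (n v : V3) : Prop := dot n v = 0.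

Definition Q8_plane (c : curve) (t0 t1 : R) (A n : V3) : Prop :=
  ((forall s, t0 <= s <= t1 -> 0 <= dot n (vsub (pt c s) A)) \/
   (forall s, t0 <= s <= t1 -> dot n (vsub (pt c s) A) <= 0)) /\
  in_plane A n (pt c t0) /\ in_plane A n (pt c t1) /\
  exists tp, (t0 < tp < t1 /\ parallel_dir n (r1 c tp)) /\
    (forall t', t0 < t' < t1 -> parallel_dir n (r1 c t') -> t' = tp) /\
    (forall s, t0 <= s <= t1 -> dist_plane A n (pt c s) <= dist_plane A n (pt c tp)) /\
    (forall s, t0 <= s <= t1 -> dist_plane A n (pt c s) = dist_plane A n (pt c tp) -> s = tp).

Definition quasi_cubic (c : curve) (t0 t1 : R) : Prop :=
  t0 < t1 /\
  exists P0 P1 P2 P3 : V3,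
    assoc_tet c t0 t1 P0 P1 P2 P3 /\ nondegenerate P0 P1 P2 P3 /\
    (forall al, lim_right (alpha c) t0 al -> parallel al (vsub P1 P0)) /\
    (forall ar, lim_left (alpha c) t1 ar -> parallel ar (vsub P3 P2)) /\
    (forall gl, lim_right (gamma c) t0 gl ->
       in_plane (pt c t0) gl P0 /\ in_plane (pt c t0) gl P1 /\ in_plane (pt c t0) gl P2) /\
    (forall gr, lim_left (gamma c) t1 gr ->
       in_plane (pt c t1) gr P1 /\ in_plane (pt c t1) gr P2 /\ in_plane (pt c t1) gr P3) /\
    (forall t, t0 <= t <= t1 -> in_tet P0 P1 P2 P3 (pt c t)) /\
    (forall t, t0 < t < t1 -> ~ singular c t) /\
    (forall t, t0 < t < t1 -> curvature c t <> 0 /\ torsion c t <> 0) /\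
    (forall a b, t0 <= a -> a < b -> b <= t1 ->
       exists S0 S1 S2 S3, assoc_tet c a b S0 S1 S2 S3 /\
         in_tet P0 P1 P2 P3 S0 /\ in_tet P0 P1 P2 P3 S1 /\
         in_tet P0 P1 P2 P3 S2 /\ in_tet P0 P1 P2 P3 S3) /\
    (exists f01 f12 f23 : R -> V3,
       (forall t, t0 < t < t1 ->
          unique_meet P0 P1 (osc c t) (f01 t) /\
          unique_meet P1 P2 (osc c t) (f12 t) /\
          unique_meet P2 P3 (osc c t) (f23 t)) /\
       strict_mono_on t0 t1 (fun t => vnorm (vsub (f01 t) P0)) /\
       strict_mono_on t0 t1 (fun t => vnorm (vsub (f12 t) P1)) /\
       strict_mono_on t0 t1 (fun t => vnorm (vsub (f23 t) P2))) /\
    (exists f03 g12 : R -> V3,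
       (forall t, t0 < t < t1 ->
          unique_meet P0 P3 (in_plane3 P1 P2 (pt c t)) (f03 t) /\
          unique_meet P1 P2 (in_plane3 P0 P3 (pt c t)) (g12 t)) /\
       strict_mono_on t0 t1 (fun t => vnorm (vsub (f03 t) P0)) /\
       strict_mono_on t0 t1 (fun t => vnorm (vsub (g12 t) P1))) /\
    Q8_plane c t0 t1 P0 (cross (vsub P2 P0) (vsub P3 P0)) /\
    Q8_plane c t0 t1 P0 (cross (vsub P1 P0) (vsub P3 P0)).

Definition is_interval (I : R -> Prop) : Prop :=
  forall a b x, I a -> I b -> a <= x <= b -> I x.

Definition nonplanar (c : curve) (I : R -> Prop) : Prop :=
  ~ exists (n : V3) (d : R), n <> vzero /\ forall t, I t -> dot n (pt c t) = d.

(* Main.v *)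
(** Write r' = X T, T' = M N, N' = K e with e a constant vector, det (T, N, e) constant and
    X, M, K > 0 on (t0, t1); such a frame exists to the right of every parameter of a non-planar
    rational curve, by dividing r' and then T' by a power of t - t0 and normalising.
    It makes the tangent curve T totally positive: det (T a, T s, T b) > 0 for a < s < b, and all the
    determinants formed from points, tangents and osculating planes get a sign by integration.
    The eight properties follow from these signs through the barycentric coordinates of r in the
    tetrahedron: the intersection points move monotonically because their ratios have Wronskians that
    factor (Pluecker relations) into such determinants, and subtetrahedra stay inside because the
    point where the tangent line at a meets the osculating plane at b is monotone in b. *)
From Stdlib Require Import Reals List Lra Lia Psatz.
Require Import Defs.
Open Scope R_scope.

(** The obstacle is [t0] itself: it may be a cusp, an inflection or a point of zero torsion, where
    the Frenet data degenerate. The frame moves all degeneration into the scalars [X], [M], [K],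
    which may vanish at [t0], whereas [T], [N], [e] stay independent up to and including [t0]; so
    the determinant signs also hold when an argument is an endpoint. The frame is triangular: [r],
    [T], [N] are iterated integrals with positive weights starting from the fixed vector [e]. This
    is the structure of a Chebyshev system, and it is what makes each sign follow from an earlier
    one. The factor [d] absorbs the handedness of the curve, so positive and negative torsion are
    treated together. Smallness of the segment enters only through the existence of the frame and
    through the absence of singular points. The latter is not a property of the frame: another,
    possibly complex, parameter could give the same point. Properness confines such parameters to a
    finite set, which a short segment to the right of [t0] avoids in its interior. *)

Lemma V3_ext (u v : V3) : vx u = vx v -> vy u = vy v -> vz u = vz v -> u = v.
Proof. destruct u, v; simpl; intros; subst; reflexivity. Qed.

Ltac vunf :=
  unfold parallel, in_plane, det3, dot, cross, vadd, vsub, vscale, vzero in *; cbn [vx vy vz] in *.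
Ltac vring := intros; try apply V3_ext; vunf; ring.

(** * Derivatives *)

Definition vder (f : R -> V3) (t : R) (l : V3) : Prop :=
  derivable_pt_lim (fun s => vx (f s)) t (vx l) /\
  derivable_pt_lim (fun s => vy (f s)) t (vy l) /\
  derivable_pt_lim (fun s => vz (f s)) t (vz l).

Lemma der_eq (f : R -> R) (t a b : R) :
  derivable_pt_lim f t a -> a = b -> derivable_pt_lim f t b.
Proof. intros H <-; exact H. Qed.

Lemma der_plus (f g : R -> R) (t a b : R) :
  derivable_pt_lim f t a -> derivable_pt_lim g t b ->
  derivable_pt_lim (fun s => f s + g s) t (a + b).
Proof. exact (derivable_pt_lim_plus f g t a b). Qed.

Lemma der_minus (f g : R -> R) (t a b : R) :
  derivable_pt_lim f t a -> derivable_pt_lim g t b ->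
  derivable_pt_lim (fun s => f s - g s) t (a - b).
Proof. exact (derivable_pt_lim_minus f g t a b). Qed.

Lemma der_mult (f g : R -> R) (t a b : R) :
  derivable_pt_lim f t a -> derivable_pt_lim g t b ->
  derivable_pt_lim (fun s => f s * g s) t (a * g t + f t * b).
Proof. exact (derivable_pt_lim_mult f g t a b). Qed.

Lemma der_const (a t : R) : derivable_pt_lim (fun _ => a) t 0.
Proof. exact (derivable_pt_lim_const a t). Qed.

Lemma der_scal (k : R) (f : R -> R) (t a : R) :
  derivable_pt_lim f t a -> derivable_pt_lim (fun s => k * f s) t (k * a).
Proof. exact (derivable_pt_lim_scal f k t a). Qed.

Lemma der_opp (f : R -> R) (t a : R) :
  derivable_pt_lim f t a -> derivable_pt_lim (fun s => - f s) t (- a).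
Proof. exact (derivable_pt_lim_opp f t a). Qed.

Lemma der_div (f g : R -> R) (t a b : R) :
  derivable_pt_lim f t a -> derivable_pt_lim g t b -> g t <> 0 ->
  derivable_pt_lim (fun s => f s / g s) t ((a * g t - f t * b) / (g t * g t)).
Proof.
  intros Hf Hg H0. eapply der_eq.
  - exact (derivable_pt_lim_div f g t a b Hf Hg H0).
  - unfold Rsqr; field; assumption.
Qed.

Lemma vder_eq (f : R -> V3) (t : R) (a b : V3) : vder f t a -> a = b -> vder f t b.
Proof. intros H <-; exact H. Qed.

Lemma vder_const (u : V3) (t : R) : vder (fun _ => u) t vzero.
Proof. repeat split; apply der_const. Qed.

Lemma vder_sub (f g : R -> V3) (t : R) (a b : V3) :
  vder f t a -> vder g t b -> vder (fun s => vsub (f s) (g s)) t (vsub a b).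
Proof.
  intros (? & ? & ?) (? & ? & ?); repeat split; simpl; apply der_minus; assumption.
Qed.

Lemma vder_cross (f g : R -> V3) (t : R) (a b : V3) :
  vder f t a -> vder g t b ->
  vder (fun s => cross (f s) (g s)) t (vadd (cross a (g t)) (cross (f t) b)).
Proof.
  intros (? & ? & ?) (? & ? & ?); repeat split; simpl;
    (eapply der_eq; [apply der_minus; apply der_mult; eassumption | simpl; ring]).
Qed.

Lemma vder_scale (k : R -> R) (f : R -> V3) (t k' : R) (a : V3) :
  derivable_pt_lim k t k' -> vder f t a ->
  vder (fun s => vscale (k s) (f s)) t (vadd (vscale k' (f t)) (vscale (k t) a)).
Proof.
  intros ? (? & ? & ?); repeat split; simpl; apply der_mult; assumption.
Qed.

Lemma der_dot (f g : R -> V3) (t : R) (a b : V3) :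
  vder f t a -> vder g t b ->
  derivable_pt_lim (fun s => dot (f s) (g s)) t (dot a (g t) + dot (f t) b).
Proof.
  intros (? & ? & ?) (? & ? & ?); unfold dot.
  eapply der_eq; [apply der_plus; [apply der_plus|]; apply der_mult; eassumption | cbv beta; ring].
Qed.

Lemma der_det3 (f g h : R -> V3) (t : R) (a b c : V3) :
  vder f t a -> vder g t b -> vder h t c ->
  derivable_pt_lim (fun s => det3 (f s) (g s) (h s)) t
    (det3 a (g t) (h t) + det3 (f t) b (h t) + det3 (f t) (g t) c).
Proof.
  intros Hf Hg Hh. eapply der_eq.
  - exact (der_dot _ _ _ _ _ Hf (vder_cross _ _ _ _ _ Hg Hh)).
  - vring.
Qed.

Lemma vder_unique (f : R -> V3) (t : R) (a b : V3) : vder f t a -> vder f t b -> a = b.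
Proof.
  intros (? & ? & ?) (? & ? & ?); apply V3_ext; eapply uniqueness_limite; eassumption.
Qed.

Lemma der_locally_eq (f g : R -> R) (t l eps : R) :
  0 < eps -> (forall s, t - eps < s < t + eps -> f s = g s) ->
  derivable_pt_lim f t l -> derivable_pt_lim g t l.
Proof.
  intros He Hfg Hf.
  apply (derivable_pt_lim_locally_ext f g t (t - eps) (t + eps)); [lra | exact Hfg | exact Hf].
Qed.

Lemma vder_locally_eq (f g : R -> V3) (t eps : R) (l : V3) :
  0 < eps -> (forall s, t - eps < s < t + eps -> f s = g s) ->
  vder f t l -> vder g t l.
Proof.
  intros He Hfg (? & ? & ?).
  repeat split; (eapply der_locally_eq; [exact He | | eassumption]);
    intros s Hs; simpl; rewrite (Hfg s Hs); reflexivity.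
Qed.

(** * Elementary inequalities; monotonicity from the sign of a derivative *)

Lemma pos_cancel (k x : R) : 0 < k -> 0 < k * x -> 0 < x.
Proof. intros; nra. Qed.

Lemma prod_pos (k x l : R) : 0 < k -> 0 < l -> 0 < k * x * l -> 0 < x.
Proof. intros Hk Hl H. assert (0 < k * l) by nra. nra. Qed.

Lemma prod_neg (k x l : R) : 0 < k -> 0 < l -> k * x * l < 0 -> x < 0.
Proof. intros Hk Hl H. assert (0 < k * l) by nra. nra. Qed.

Lemma div_cancel (x y : R) : y <> 0 -> x / y * y = x.
Proof. intros; field; assumption. Qed.

Lemma div_nonneg (x y : R) : 0 <= x -> 0 < y -> 0 <= x / y.
Proof. exact (Rle_mult_inv_pos x y). Qed.

Lemma div_le_1 (x y : R) : x <= y -> 0 < y -> x / y <= 1.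
Proof. intros. apply (Rmult_le_reg_r y); [|rewrite div_cancel]; lra. Qed.

Lemma div_opp_opp (x y : R) : y <> 0 -> x / y = - x / - y.
Proof. intros; field; assumption. Qed.

(** The share [a / (a + b)] is an increasing function of the ratio [a / b], whose comparison is
    given here in cross-multiplied form. *)
Lemma share_incr (a b a' b' : R) :
  0 < a -> 0 < b -> 0 < a' -> 0 < b' -> a * b' < a' * b -> a / (a + b) < a' / (a' + b').
Proof.
  intros. apply (Rmult_lt_reg_r ((a + b) * (a' + b'))); [nra|].
  replace (a / (a + b) * ((a + b) * (a' + b'))) with (a * (a' + b')) by (field; lra).
  replace (a' / (a' + b') * ((a + b) * (a' + b'))) with (a' * (a + b)) by (field; lra).
  nra.
Qed.

Lemma incr_of_der (f f' : R -> R) (a b : R) :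
  a < b -> (forall c, a <= c <= b -> derivable_pt_lim f c (f' c)) ->
  (forall c, a < c < b -> 0 < f' c) -> f a < f b.
Proof.
  intros Hab Hd Hp. destruct (MVT_cor2 f f' a b Hab Hd) as (c & E & Hc).
  specialize (Hp c Hc). nra.
Qed.

Lemma decr_of_der (f f' : R -> R) (a b : R) :
  a < b -> (forall c, a <= c <= b -> derivable_pt_lim f c (f' c)) ->
  (forall c, a < c < b -> f' c < 0) -> f b < f a.
Proof.
  intros Hab Hd Hp. destruct (MVT_cor2 f f' a b Hab Hd) as (c & E & Hc).
  specialize (Hp c Hc). nra.
Qed.

(** The Wronskian is the numerator of the derivative of [f / g]. The conclusion is cross-multiplied
    so that it can feed [share_incr]. *)
Lemma ratio_incr (f g f' g' : R -> R) (a b : R) :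
  a < b -> (forall c, a <= c <= b -> derivable_pt_lim f c (f' c)) ->
  (forall c, a <= c <= b -> derivable_pt_lim g c (g' c)) ->
  (forall c, a <= c <= b -> 0 < g c) ->
  (forall c, a < c < b -> 0 < f' c * g c - f c * g' c) -> f a * g b < f b * g a.
Proof.
  intros Hab Hf Hg Hp HW.
  assert (H : f a / g a < f b / g b).
  { apply (incr_of_der (fun c => f c / g c)
      (fun c => (f' c * g c - f c * g' c) / (g c * g c))); trivial.
    - intros c Hc. apply der_div; auto. specialize (Hp c Hc); lra.
    - intros c Hc. specialize (HW c Hc). specialize (Hp c ltac:(lra)).
      apply Rdiv_lt_0_compat; [lra | nra]. }
  pose proof (Hp a ltac:(lra)) as Ha. pose proof (Hp b ltac:(lra)) as Hb.
  apply (Rmult_lt_compat_r (g a * g b)) in H; [|nra].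
  replace (f a / g a * (g a * g b)) with (f a * g b) in H by (field; lra).
  replace (f b / g b * (g a * g b)) with (f b * g a) in H by (field; lra).
  exact H.
Qed.

Lemma const_of_der (f : R -> R) (a b : R) :
  a <= b -> (forall c, a <= c <= b -> derivable_pt_lim f c 0) -> f a = f b.
Proof.
  intros Hab Hd. destruct (Req_dec a b) as [->|Hne]; [reflexivity|].
  destruct (MVT_cor2 f (fun _ => 0) a b) as (c & E & Hc); [lra | exact Hd | lra].
Qed.

Lemma in_tet_convex (A B C D Y Z : V3) (k : R) :
  0 <= k <= 1 -> in_tet A B C D Y -> in_tet A B C D Z ->
  in_tet A B C D (vadd (vscale (1 - k) Y) (vscale k Z)).
Proof.
  intros Hk (a0 & a1 & a2 & a3 & ? & ? & ? & ? & Ea & ->) (b0 & b1 & b2 & b3 & ? & ? & ? & ? & Eb & ->).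
  exists ((1 - k) * a0 + k * b0), ((1 - k) * a1 + k * b1), ((1 - k) * a2 + k * b2),
    ((1 - k) * a3 + k * b3).
  repeat split; try nra. vring.
Qed.

(** * Curves with a moving triangular frame *)

(** Derivatives and independence are required on the closed interval, positivity of [X], [M], [K]
    only on the open one: this is what admits a degenerate starting point. [d] normalises the
    constant determinant to 1 and carries its sign. *)
Record frame (t0 t1 : R) (r T N : R -> V3) (e : V3) (X M K : R -> R) (d : R) : Prop := {
  fr_lt : t0 < t1;
  fr_r : forall t, t0 <= t <= t1 -> vder r t (vscale (X t) (T t));
  fr_T : forall t, t0 <= t <= t1 -> vder T t (vscale (M t) (N t));
  fr_N : forall t, t0 <= t <= t1 -> vder N t (vscale (K t) e);
  fr_X : forall t, t0 < t < t1 -> 0 < X t;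
  fr_M : forall t, t0 < t < t1 -> 0 < M t;
  fr_K : forall t, t0 < t < t1 -> 0 < K t;
  fr_d : forall t, t0 <= t <= t1 -> d * det3 (T t) (N t) e = 1
}.

Section Frame.
Context (t0 t1 : R) (r T N : R -> V3) (e : V3) (X M K : R -> R) (d : R).
Context (F : frame t0 t1 r T N e X M K d).

Local Notation dt u v w := (d * det3 u v w).
Local Notation J t := (t0 <= t <= t1).

Ltac vd := lazymatch goal with
  | |- vder (fun s => vsub _ _) _ _ => apply vder_sub; vd
  | |- vder (fun s => cross _ _) _ _ => apply vder_cross; vd
  | |- vder (fun s => r s) _ _ => apply (fr_r _ _ _ _ _ _ _ _ _ _ F); try lra
  | |- vder (fun s => T s) _ _ => apply (fr_T _ _ _ _ _ _ _ _ _ _ F); try lra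
  | |- vder (fun s => N s) _ _ => apply (fr_N _ _ _ _ _ _ _ _ _ _ F); try lra
  | |- vder r _ _ => apply (fr_r _ _ _ _ _ _ _ _ _ _ F); try lra
  | |- vder T _ _ => apply (fr_T _ _ _ _ _ _ _ _ _ _ F); try lra
  | |- vder N _ _ => apply (fr_N _ _ _ _ _ _ _ _ _ _ F); try lra
  | |- vder _ _ _ => apply vder_const
  end.

Ltac dd := intros; eapply der_eq; [apply der_scal, der_det3; vd | vunf; ring].

Let HX := fr_X _ _ _ _ _ _ _ _ _ _ F.
Let HM := fr_M _ _ _ _ _ _ _ _ _ _ F.
Let HK := fr_K _ _ _ _ _ _ _ _ _ _ F.
Let Hd := fr_d _ _ _ _ _ _ _ _ _ _ F.
Let Hlt := fr_lt _ _ _ _ _ _ _ _ _ _ F.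

(** * Signs of the determinants formed from tangents, normals and chords *)

(** Moving [N] alone adds multiples of [e], which the last column cancels; so the normalisation
    persists with [T] and [N] at different parameters. *)
Lemma det_TNe (a s : R) : J a -> J s -> dt (T a) (N s) e = 1.
Proof.
  intros Ha Hs.
  assert (C : forall x y, x <= y -> J x -> J y -> dt (T a) (N x) e = dt (T a) (N y) e).
  { intros x y Hxy Hx Hy. apply (const_of_der (fun s => dt (T a) (N s) e)); [lra|]. dd. }
  rewrite <- (Hd a Ha). destruct (Rle_dec a s); [symmetry|]; apply C; lra.
Qed.

(** Pattern of most sign lemmas below: one argument is moved from a position where the determinant
    has a repeated or zero column, and the derivative is [X], [M] or [K] times a determinant whose
    sign is already known. *)
Lemma det_TNN_pos (a b : R) : J a -> J b -> a < b -> 0 < dt (T a) (N a) (N b).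
Proof.
  intros Ha Hb Hab.
  replace 0 with (dt (T a) (N a) (N a)) by vring.
  apply (incr_of_der (fun s => dt (T a) (N a) (N s)) (fun s => K s * dt (T a) (N a) e)); trivial.
  - dd.
  - intros c Hc. rewrite det_TNe by lra. assert (0 < K c) by (apply HK; lra). lra.
Qed.

Lemma det_TNN_neg (a b : R) : J a -> J b -> b < a -> dt (T a) (N a) (N b) < 0.
Proof.
  intros Ha Hb Hab.
  replace 0 with (dt (T a) (N a) (N a)) by vring.
  apply (incr_of_der (fun s => dt (T a) (N a) (N s)) (fun s => K s * dt (T a) (N a) e)); trivial.
  - dd.
  - intros c Hc. rewrite det_TNe by lra. assert (0 < K c) by (apply HK; lra). lra.
Qed.

(** The integrand [dt (T b) (N b) (N c)] changes sign at [c = b], so the determinant touches zero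
    there without changing sign: all other tangent directions point to the same side of the
    osculating plane at [b]. *)
Lemma det_TNT_pos (a b : R) : J a -> J b -> a <> b -> 0 < dt (T b) (N b) (T a).
Proof.
  intros Ha Hb Hab. replace 0 with (dt (T b) (N b) (T b)) by vring.
  destruct (Rlt_le_dec a b) as [L|L].
  - apply (decr_of_der (fun s => dt (T b) (N b) (T s)) (fun s => M s * dt (T b) (N b) (N s))); trivial.
    + dd.
    + intros c Hc. assert (0 < M c) by (apply HM; lra).
      assert (dt (T b) (N b) (N c) < 0) by (apply det_TNN_neg; lra). nra.
  - apply (incr_of_der (fun s => dt (T b) (N b) (T s)) (fun s => M s * dt (T b) (N b) (N s))).
    + lra.
    + dd.
    + intros c Hc. assert (0 < M c) by (apply HM; lra).
      assert (0 < dt (T b) (N b) (N c)) by (apply det_TNN_pos; lra). nra.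
Qed.

Lemma det_TTe_pos (a s : R) : J a -> J s -> a < s -> 0 < dt (T a) (T s) e.
Proof.
  intros Ha Hs Has. replace 0 with (dt (T a) (T a) e) by vring.
  apply (incr_of_der (fun s => dt (T a) (T s) e) (fun s => M s * dt (T a) (N s) e)); trivial.
  - dd.
  - intros c Hc. rewrite det_TNe by lra. assert (0 < M c) by (apply HM; lra). lra.
Qed.

(** For [b = s] this is a cyclic rotation of [det_TNT_pos]; moving [N] from [s] on to [b] only
    increases the value. *)
Lemma det_TTN_pos (a s b : R) : J a -> J b -> a < s <= b -> 0 < dt (T a) (T s) (N b).
Proof.
  intros Ha Hb Hs.
  assert (H : 0 < dt (T a) (T s) (N s)).
  { replace (dt (T a) (T s) (N s)) with (dt (T s) (N s) (T a)) by vring.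
    apply det_TNT_pos; lra. }
  destruct (Req_dec s b) as [<-|Hne]; [exact H|].
  apply Rlt_trans with (1 := H).
  apply (incr_of_der (fun s' => dt (T a) (T s) (N s')) (fun s' => K s' * dt (T a) (T s) e)).
  - lra.
  - dd.
  - intros c Hc. assert (0 < K c) by (apply HK; lra).
    assert (0 < dt (T a) (T s) e) by (apply det_TTe_pos; lra). nra.
Qed.

Lemma det_TTT_pos (a s b : R) : J a -> J b -> a < s < b -> 0 < dt (T a) (T s) (T b).
Proof.
  intros Ha Hb Hs. replace 0 with (dt (T a) (T s) (T s)) by vring.
  apply (incr_of_der (fun s' => dt (T a) (T s) (T s')) (fun s' => M s' * dt (T a) (T s) (N s'))).
  - lra.
  - dd.
  - intros c Hc. assert (0 < M c) by (apply HM; lra).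
    assert (0 < dt (T a) (T s) (N c)) by (apply det_TTN_pos; lra). nra.
Qed.

Lemma det_TrT_pos_lt (a b : R) : J a -> J b -> a < b -> 0 < dt (T a) (vsub (r b) (r a)) (T b).
Proof.
  intros Ha Hb Hab. replace 0 with (dt (T a) (vsub (r a) (r a)) (T b)) by vring.
  apply (incr_of_der (fun s => dt (T a) (vsub (r s) (r a)) (T b))
                     (fun s => X s * dt (T a) (T s) (T b))); trivial.
  - dd.
  - intros c Hc. assert (0 < X c) by (apply HX; lra).
    assert (0 < dt (T a) (T c) (T b)) by (apply det_TTT_pos; lra). nra.
Qed.

(** Exchanging [a] and [b] reverses the chord and swaps the outer columns; the two signs cancel. *)
Lemma det_TrT_pos (a b : R) : J a -> J b -> a <> b -> 0 < dt (T a) (vsub (r b) (r a)) (T b).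
Proof.
  intros Ha Hb Hab. destruct (Rlt_le_dec a b) as [L|L].
  - apply det_TrT_pos_lt; assumption.
  - replace (dt (T a) (vsub (r b) (r a)) (T b)) with (dt (T b) (vsub (r a) (r b)) (T a)) by vring.
    apply det_TrT_pos_lt; lra.
Qed.

(** Since [det_TNT_pos] has the same sign on both sides of [b], its integral changes sign: the curve
    crosses its osculating plane at [b]. This lemma and the next one are the two sides. *)
Lemma det_TNr_neg (a b : R) : J a -> J b -> a < b -> dt (T b) (N b) (vsub (r a) (r b)) < 0.
Proof.
  intros Ha Hb Hab. replace 0 with (dt (T b) (N b) (vsub (r b) (r b))) by vring.
  apply (incr_of_der (fun s => dt (T b) (N b) (vsub (r s) (r b)))
                     (fun s => X s * dt (T b) (N b) (T s))); trivial.
  - dd.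
  - intros c Hc. assert (0 < X c) by (apply HX; lra).
    assert (0 < dt (T b) (N b) (T c)) by (apply det_TNT_pos; lra). nra.
Qed.

Lemma det_TNr_pos (a b : R) : J a -> J b -> b < a -> 0 < dt (T b) (N b) (vsub (r a) (r b)).
Proof.
  intros Ha Hb Hab. replace 0 with (dt (T b) (N b) (vsub (r b) (r b))) by vring.
  apply (incr_of_der (fun s => dt (T b) (N b) (vsub (r s) (r b)))
                     (fun s => X s * dt (T b) (N b) (T s))); trivial.
  - dd.
  - intros c Hc. assert (0 < X c) by (apply HX; lra).
    assert (0 < dt (T b) (N b) (T c)) by (apply det_TNT_pos; lra). nra.
Qed.

(** Two integrations of [det_TTT_pos]: [Q] turns the first tangent into the chord ending at [t], and
    the main argument then turns the last one into the chord starting at [t]. *)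
Lemma det_rTr_pos (a t b : R) :
  J a -> J b -> a < t < b -> 0 < dt (vsub (r t) (r a)) (T t) (vsub (r b) (r t)).
Proof.
  intros Ha Hb Ht.
  assert (Q : forall s, t < s -> J s -> 0 < dt (vsub (r t) (r a)) (T t) (T s)).
  { intros s Hs Js. replace 0 with (dt (vsub (r t) (r t)) (T t) (T s)) by vring.
    apply (decr_of_der (fun u => dt (vsub (r t) (r u)) (T t) (T s))
                       (fun u => - (X u * dt (T u) (T t) (T s)))).
    - lra.
    - dd.
    - intros c Hc. assert (0 < X c) by (apply HX; lra).
      assert (0 < dt (T c) (T t) (T s)) by (apply det_TTT_pos; lra). nra. }
  replace 0 with (dt (vsub (r t) (r a)) (T t) (vsub (r t) (r t))) by vring.
  apply (incr_of_der (fun s => dt (vsub (r t) (r a)) (T t) (vsub (r s) (r t)))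
                     (fun s => X s * dt (vsub (r t) (r a)) (T t) (T s))).
  - lra.
  - dd.
  - intros c Hc. assert (0 < X c) by (apply HX; lra). specialize (Q c). nra.
Qed.

(* [ttop a b] locates the intersection of the tangent line at [a] with the osculating plane at [b]. *)
Definition ttop (a b : R) : R :=
  - (dt (T b) (N b) (vsub (r a) (r b)) / dt (T b) (N b) (T a)).
Definition tpt (a b : R) : V3 := vadd (r a) (vscale (ttop a b) (T a)).

Lemma ttop_pos (a b : R) : J a -> J b -> a < b -> 0 < ttop a b.
Proof.
  intros Ha Hb Hab. unfold ttop.
  assert (0 < dt (T b) (N b) (T a)) by (apply det_TNT_pos; lra).
  assert (dt (T b) (N b) (vsub (r a) (r b)) < 0) by (apply det_TNr_neg; lra).
  rewrite <- Rdiv_opp_l. apply Rdiv_pos_pos; lra.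
Qed.

Lemma ttop_neg (a b : R) : J a -> J b -> b < a -> ttop a b < 0.
Proof.
  intros Ha Hb Hab. unfold ttop.
  assert (0 < dt (T b) (N b) (T a)) by (apply det_TNT_pos; lra).
  assert (0 < dt (T b) (N b) (vsub (r a) (r b))) by (apply det_TNr_pos; lra).
  apply Ropp_lt_gt_0_contravar. apply Rdiv_pos_pos; lra.
Qed.

(** Differentiating in [b] replaces [N b] by [K b] times [e] in both determinants of the quotient,
    so the numerator of the derivative is a Pluecker expression. It factors into [K], the unit
    determinant of the frame and [det_TrT_pos]. The last hypothesis keeps the moving parameter away
    from [a], where the quotient is 0/0. *)
Lemma ttop_incr (a b c : R) : J a -> J b -> J c -> b < c -> (a < b \/ c < a) -> ttop a b < ttop a c.
Proof.
  intros Ha Hb Hc Hbc Hor. unfold ttop.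
  apply (incr_of_der (fun b => - (dt (T b) (N b) (vsub (r a) (r b)) / dt (T b) (N b) (T a)))
    (fun b => K b * dt (T a) (vsub (r b) (r a)) (T b) /
               (dt (T b) (N b) (T a) * dt (T b) (N b) (T a)))); trivial.
  - intros x Hx.
    assert (H : dt (T x) (N x) (T a) <> 0).
    { apply Rgt_not_eq, det_TNT_pos; lra. }
    eapply der_eq.
    + apply der_opp, der_div; [apply der_scal, der_det3; vd | apply der_scal, der_det3; vd | exact H].
    + rewrite <- Rdiv_opp_l. f_equal.
      transitivity (K x * (dt (T x) (N x) e) * dt (T a) (vsub (r x) (r a)) (T x)).
      * vring.
      * rewrite Hd by lra. ring.
  - intros x Hx. assert (0 < K x) by (apply HK; lra).
    assert (0 < dt (T x) (N x) (T a)) by (apply det_TNT_pos; lra).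
    assert (0 < dt (T a) (vsub (r x) (r a)) (T x)) by (apply det_TrT_pos; lra).
    apply Rdiv_pos_pos; nra.
Qed.

Lemma tpt_plane (a b : R) : J a -> J b -> a <> b -> dt (T b) (N b) (vsub (tpt a b) (r b)) = 0.
Proof.
  intros Ha Hb Hab. assert (H : 0 < dt (T b) (N b) (T a)) by (apply det_TNT_pos; lra).
  transitivity (dt (T b) (N b) (vsub (r a) (r b)) + ttop a b * dt (T b) (N b) (T a)).
  - unfold tpt. vring.
  - unfold ttop. field. split; intro E0; rewrite E0 in H; lra.
Qed.

(** * The two planes through the chord and an end tangent *)

Local Notation T0 := (T t0).
Local Notation T1 := (T t1).
Local Notation v := (vsub (r t1) (r t0)).

Lemma chord_det_pos : 0 < dt T0 v T1.
Proof. apply det_TrT_pos; lra. Qed.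

(* Rolle gives the zero [p]. The functional [det (v, T1, _)] vanishes at [T p] and [T1], so on [T t]
   it is a positive multiple of [det (T t, T p, T1)]. *)
Lemma hump_left :
  exists p, t0 < p < t1 /\ dt v T1 (T p) = 0 /\
    (forall t, t0 <= t < p -> 0 < dt v T1 (T t)) /\
    (forall t, p < t < t1 -> dt v T1 (T t) < 0) /\
    (forall t, t0 <= t <= p -> dt v T1 (N t) < 0).
Proof.
  pose proof chord_det_pos as HD.
  destruct (MVT_cor2 (fun t => dt v T1 (vsub (r t) (r t0))) (fun t => X t * dt v T1 (T t)) t0 t1)
    as (p & Ep & Hp); [lra | dd |].
  assert (Zp : dt v T1 (T p) = 0).
  { assert (0 < X p) by (apply HX; lra).
    replace (dt v T1 v - dt v T1 (vsub (r t0) (r t0))) with 0 in Ep by vring.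
    assert (0 < X p * (t1 - t0)) by nra. nra. }
  assert (H0 : 0 < dt v T1 T0) by (replace (dt v T1 T0) with (dt T0 v T1) by vring; exact HD).
  assert (Q : forall t, dt v T1 (T t) * dt T0 (T p) T1 = dt v T1 T0 * dt (T t) (T p) T1).
  { intros t.
    transitivity (dt v T1 T0 * dt (T t) (T p) T1 + dt v T1 (T p) * dt T0 (T t) T1).
    - vring.
    - rewrite Zp; ring. }
  assert (Hpos : 0 < dt T0 (T p) T1) by (apply det_TTT_pos; lra).
  assert (S1 : forall t, t0 <= t < p -> 0 < dt v T1 (T t)).
  { intros t Ht. specialize (Q t).
    assert (0 < dt (T t) (T p) T1) by (apply det_TTT_pos; lra). nra. }
  assert (S2 : forall t, p < t < t1 -> dt v T1 (T t) < 0).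
  { intros t Ht. specialize (Q t).
    assert (H : 0 < dt (T p) (T t) T1) by (apply det_TTT_pos; lra).
    replace (dt (T t) (T p) T1) with (- dt (T p) (T t) T1) in Q by vring. nra. }
  exists p; repeat split; try lra; trivial.
  (* For the normals: [dt v T1 (N t)] has derivative [K t] times the constant [dt v T1 e], so it is
     monotone. A negative value at [x < p] and a zero at [y > p] make the constant positive, hence
     the function is negative up to [p]. *)
  destruct (MVT_cor2 (fun t => dt v T1 (T t)) (fun t => M t * dt v T1 (N t)) t0 p)
    as (x & Ex & Hx); [lra | dd |].
  destruct (MVT_cor2 (fun t => dt v T1 (T t)) (fun t => M t * dt v T1 (N t)) p t1)
    as (y & Ey & Hy); [lra | dd |].
  assert (Nx : dt v T1 (N x) < 0) by
    (assert (0 < M x) by (apply HM; lra); apply (prod_neg (M x) _ (p - t0)); lra).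
  assert (Ny : dt v T1 (N y) = 0).
  { assert (0 < M y) by (apply HM; lra). replace (dt v T1 T1) with 0 in Ey by vring.
    assert (0 < M y * (t1 - p)) by nra. nra. }
  destruct (MVT_cor2 (fun t => dt v T1 (N t)) (fun t => K t * dt v T1 e) x y)
    as (z & Ez & Hz); [lra | dd |].
  assert (He : 0 < dt v T1 e)
    by (assert (0 < K z) by (apply HK; lra); apply (prod_pos (K z) _ (y - x)); lra).
  intros t Ht. rewrite <- Ny.
  apply (incr_of_der (fun t => dt v T1 (N t)) (fun t => K t * dt v T1 e)); [lra | dd |].
  intros s Hs. assert (0 < K s) by (apply HK; lra). nra.
Qed.

(** Mirror image of [hump_left]. The functional [dt v T0] now vanishes at the left end tangent, so
    the half-open ranges change sides and the normals are controlled after [p]. *)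
Lemma hump_right :
  exists p, t0 < p < t1 /\ dt v T0 (T p) = 0 /\
    (forall t, t0 < t < p -> 0 < dt v T0 (T t)) /\
    (forall t, p < t <= t1 -> dt v T0 (T t) < 0) /\
    (forall t, p <= t <= t1 -> dt v T0 (N t) < 0).
Proof.
  pose proof chord_det_pos as HD.
  destruct (MVT_cor2 (fun t => dt v T0 (vsub (r t) (r t0))) (fun t => X t * dt v T0 (T t)) t0 t1)
    as (p & Ep & Hp); [lra | dd |].
  assert (Zp : dt v T0 (T p) = 0).
  { assert (0 < X p) by (apply HX; lra).
    replace (dt v T0 v - dt v T0 (vsub (r t0) (r t0))) with 0 in Ep by vring.
    assert (0 < X p * (t1 - t0)) by nra. nra. }
  assert (H0 : dt v T0 T1 < 0) by (replace (dt v T0 T1) with (- dt T0 v T1) by vring; lra).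
  assert (Q : forall t, dt v T0 (T t) * dt T0 (T p) T1 = dt v T0 T1 * dt T0 (T p) (T t)).
  { intros t.
    transitivity (dt v T0 T1 * dt T0 (T p) (T t) + dt v T0 (T p) * dt T0 (T t) T1).
    - vring.
    - rewrite Zp; ring. }
  assert (Hpos : 0 < dt T0 (T p) T1) by (apply det_TTT_pos; lra).
  assert (S1 : forall t, t0 < t < p -> 0 < dt v T0 (T t)).
  { intros t Ht. specialize (Q t).
    assert (H : 0 < dt T0 (T t) (T p)) by (apply det_TTT_pos; lra).
    replace (dt T0 (T p) (T t)) with (- dt T0 (T t) (T p)) in Q by vring. nra. }
  assert (S2 : forall t, p < t <= t1 -> dt v T0 (T t) < 0).
  { intros t Ht. specialize (Q t).
    assert (0 < dt T0 (T p) (T t)) by (apply det_TTT_pos; lra). nra. }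
  exists p; repeat split; try lra; trivial.
  destruct (MVT_cor2 (fun t => dt v T0 (T t)) (fun t => M t * dt v T0 (N t)) t0 p)
    as (x & Ex & Hx); [lra | dd |].
  destruct (MVT_cor2 (fun t => dt v T0 (T t)) (fun t => M t * dt v T0 (N t)) p t1)
    as (y & Ey & Hy); [lra | dd |].
  assert (Nx : dt v T0 (N x) = 0).
  { assert (0 < M x) by (apply HM; lra). replace (dt v T0 T0) with 0 in Ex by vring.
    assert (0 < M x * (p - t0)) by nra. nra. }
  assert (Ny : dt v T0 (N y) < 0) by
    (assert (0 < M y) by (apply HM; lra); apply (prod_neg (M y) _ (t1 - p)); lra).
  destruct (MVT_cor2 (fun t => dt v T0 (N t)) (fun t => K t * dt v T0 e) x y)
    as (z & Ez & Hz); [lra | dd |].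
  assert (He : dt v T0 e < 0)
    by (assert (0 < K z) by (apply HK; lra); apply (prod_neg (K z) _ (y - x)); lra).
  intros t Ht. rewrite <- Nx.
  apply (decr_of_der (fun t => dt v T0 (N t)) (fun t => K t * dt v T0 e)); [lra | dd |].
  intros s Hs. assert (0 < K s) by (apply HK; lra). nra.
Qed.

(** The plane through [r t0] spanned by the chord and [T1] is a face of the tetrahedron. The height
    above it is zero at both ends, increases up to the hump and decreases after it. *)
Lemma side_left_pos (t : R) : t0 < t < t1 -> 0 < dt v T1 (vsub (r t) (r t0)).
Proof.
  intros Ht. destruct hump_left as (p & Hp & _ & S1 & S2 & _).
  destruct (Rle_lt_dec t p) as [L|L].
  - replace 0 with (dt v T1 (vsub (r t0) (r t0))) by vring.
    apply (incr_of_der (fun t => dt v T1 (vsub (r t) (r t0))) (fun t => X t * dt v T1 (T t)));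
      [lra | dd |].
    intros s Hs. assert (0 < X s) by (apply HX; lra). specialize (S1 s). nra.
  - replace 0 with (dt v T1 v) by vring.
    apply (decr_of_der (fun t => dt v T1 (vsub (r t) (r t0))) (fun t => X t * dt v T1 (T t)));
      [lra | dd |].
    intros s Hs. assert (0 < X s) by (apply HX; lra). specialize (S2 s). nra.
Qed.

Lemma side_right_pos (t : R) : t0 < t < t1 -> 0 < dt v T0 (vsub (r t) (r t0)).
Proof.
  intros Ht. destruct hump_right as (p & Hp & _ & S1 & S2 & _).
  destruct (Rle_lt_dec t p) as [L|L].
  - replace 0 with (dt v T0 (vsub (r t0) (r t0))) by vring.
    apply (incr_of_der (fun t => dt v T0 (vsub (r t) (r t0))) (fun t => X t * dt v T0 (T t)));
      [lra | dd |].
    intros s Hs. assert (0 < X s) by (apply HX; lra). specialize (S1 s). nra.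
  - replace 0 with (dt v T0 v) by vring.
    apply (decr_of_der (fun t => dt v T0 (vsub (r t) (r t0))) (fun t => X t * dt v T0 (T t)));
      [lra | dd |].
    intros s Hs. assert (0 < X s) by (apply HX; lra). specialize (S2 s). nra.
Qed.

Lemma side_left_nonneg (t : R) : J t -> 0 <= dt v T1 (vsub (r t) (r t0)).
Proof.
  intros Ht. destruct (Req_dec t t0) as [->|]; [right; vring|].
  destruct (Req_dec t t1) as [->|]; [right; vring|].
  left; apply side_left_pos; lra.
Qed.

Lemma side_right_nonneg (t : R) : J t -> 0 <= dt v T0 (vsub (r t) (r t0)).
Proof.
  intros Ht. destruct (Req_dec t t0) as [->|]; [right; vring|].
  destruct (Req_dec t t1) as [->|]; [right; vring|].
  left; apply side_right_pos; lra.
Qed.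

(** * The tetrahedron of the whole segment and its barycentric coordinates *)

Local Notation P0 := (r t0).
Local Notation P1 := (tpt t0 t1).
Local Notation P2 := (tpt t1 t0).
Local Notation P3 := (r t1).
Local Notation L0 := (ttop t0 t1).
Local Notation L1 := (ttop t1 t0).

Lemma tet_volume : dt (vsub P1 P0) (vsub P2 P0) (vsub P3 P0) = - L0 * L1 * dt T0 v T1.
Proof. unfold tpt. vring. Qed.

Lemma tet_volume_pos : 0 < dt (vsub P1 P0) (vsub P2 P0) (vsub P3 P0).
Proof.
  rewrite tet_volume. pose proof chord_det_pos.
  assert (0 < L0) by (apply ttop_pos; lra). assert (L1 < 0) by (apply ttop_neg; lra).
  assert (0 < - L0 * L1) by nra. nra.
Qed.

(* Barycentric coordinates, with respect to P1, P2, P3, of the point [P0 + Y]. *)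
Definition bary1 (Y : V3) : R := dt v T1 Y / (L0 * dt T0 v T1).
Definition bary2 (Y : V3) : R := dt v T0 Y / (- L1 * dt T0 v T1).
Definition bary3 (Y : V3) : R := dt T0 (N t0) Y / dt T0 (N t0) v.

Lemma tet_denominators :
  0 < L0 /\ L1 < 0 /\ 0 < dt T0 v T1 /\ 0 < dt T0 (N t0) v /\ dt T1 (N t1) (vsub P0 P3) < 0.
Proof.
  repeat split.
  - apply ttop_pos; lra.
  - apply ttop_neg; lra.
  - exact chord_det_pos.
  - apply det_TNr_pos; lra.
  - apply det_TNr_neg; lra.
Qed.

(** Cramer's rule gives some coefficients. Each functional in [bary1], [bary2], [bary3] kills two of
    the three edge vectors at [P0], hence reads off the remaining coefficient. *)
Lemma bary_decomp (Y : V3) :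
  Y = vadd (vadd (vscale (bary1 Y) (vsub P1 P0)) (vscale (bary2 Y) (vsub P2 P0)))
        (vscale (bary3 Y) (vsub P3 P0)).
Proof.
  destruct tet_denominators as (H0 & H1 & HD & Hc & _).
  pose proof tet_volume_pos as HV.
  set (u1 := vsub P1 P0) in *. set (u2 := vsub P2 P0) in *.
  assert (0 < L0 * dt T0 v T1) by (apply Rmult_lt_0_compat; lra).
  assert (0 < - L1 * dt T0 v T1) by (apply Rmult_lt_0_compat; lra).
  assert (HV' : det3 u1 u2 v <> 0) by (intro E; rewrite E in HV; lra).
  assert (EY : exists a1 a2 a3, Y = vadd (vadd (vscale a1 u1) (vscale a2 u2)) (vscale a3 v)).
  { exists (det3 Y u2 v / det3 u1 u2 v), (det3 u1 Y v / det3 u1 u2 v),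
      (det3 u1 u2 Y / det3 u1 u2 v).
    clearbody u1 u2. generalize v HV'; clear. intros w HV'.
    apply V3_ext; vunf; field; exact HV'. }
  destruct EY as (a1 & a2 & a3 & ->).
  (* [P2] lies in the osculating plane at [t0], so the functional of [bary3] kills the edge to [P2]
     as well as the one along [T0]. *)
  assert (E2 : dt T0 (N t0) u2 = 0) by (apply tpt_plane; lra).
  assert (E : bary1 (vadd (vadd (vscale a1 u1) (vscale a2 u2)) (vscale a3 v)) = a1 /\
              bary2 (vadd (vadd (vscale a1 u1) (vscale a2 u2)) (vscale a3 v)) = a2 /\
              bary3 (vadd (vadd (vscale a1 u1) (vscale a2 u2)) (vscale a3 v)) = a3).
  { repeat split.
    - unfold bary1. apply (Rmult_eq_reg_r (L0 * dt T0 v T1)); [|lra].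
      rewrite div_cancel by lra. unfold u1, u2, tpt. vring.
    - unfold bary2. apply (Rmult_eq_reg_r (- L1 * dt T0 v T1)); [|lra].
      rewrite div_cancel by lra. unfold u1, u2, tpt. vring.
    - unfold bary3. apply (Rmult_eq_reg_r (dt T0 (N t0) v)); [|lra].
      rewrite div_cancel by lra.
      transitivity (a2 * dt T0 (N t0) u2 + a3 * dt T0 (N t0) v); [|rewrite E2; ring].
      unfold u1, tpt. clearbody u2. vring. }
  destruct E as (-> & -> & ->). reflexivity.
Qed.

(** [P1], [P2], [P3] all lie in the osculating plane at [t1]; the coordinate belonging to [P0] is
    therefore the affine function vanishing on that plane, normalised to 1 at [P0]. *)
Lemma bary0_eq (Y : V3) :
  1 - bary1 Y - bary2 Y - bary3 Y =
  dt T1 (N t1) (vsub (vadd P0 Y) P3) / dt T1 (N t1) (vsub P0 P3).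
Proof.
  destruct tet_denominators as (_ & _ & _ & _ & Hc).
  assert (E1 : dt T1 (N t1) (vsub P1 P3) = 0) by (apply tpt_plane; lra).
  apply (Rmult_eq_reg_r (dt T1 (N t1) (vsub P0 P3))); [|lra].
  rewrite div_cancel by lra.
  rewrite (bary_decomp Y) at 4.
  generalize (bary1 Y) (bary2 Y) (bary3 Y); intros a1 a2 a3.
  transitivity (a1 * dt T1 (N t1) (vsub P1 P3) + (1 - a1 - a2 - a3) * dt T1 (N t1) (vsub P0 P3));
    [rewrite E1; ring|].
  generalize P1; intros p1. unfold tpt. vring.
Qed.

Lemma in_tet_intro (Z : V3) :
  0 <= dt v T1 (vsub Z P0) -> 0 <= dt v T0 (vsub Z P0) ->
  0 <= dt T0 (N t0) (vsub Z P0) -> dt T1 (N t1) (vsub Z P3) <= 0 ->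
  in_tet P0 P1 P2 P3 Z.
Proof.
  destruct tet_denominators as (H0 & H1 & HD & H2 & H3).
  intros Z1 Z2 Z3 Z0. pose proof (bary_decomp (vsub Z P0)) as E.
  pose proof (bary0_eq (vsub Z P0)) as E0.
  replace (vsub (vadd P0 (vsub Z P0)) P3) with (vsub Z P3) in E0 by vring.
  assert (K1 : 0 <= bary1 (vsub Z P0)) by (apply div_nonneg; nra).
  assert (K2 : 0 <= bary2 (vsub Z P0)) by (apply div_nonneg; nra).
  assert (K3 : 0 <= bary3 (vsub Z P0)) by (apply div_nonneg; nra).
  assert (K0 : 0 <= 1 - bary1 (vsub Z P0) - bary2 (vsub Z P0) - bary3 (vsub Z P0)).
  { rewrite E0, div_opp_opp by lra. apply div_nonneg; lra. }
  exists (1 - bary1 (vsub Z P0) - bary2 (vsub Z P0) - bary3 (vsub Z P0)),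
    (bary1 (vsub Z P0)), (bary2 (vsub Z P0)), (bary3 (vsub Z P0)).
  repeat split; trivial; [ring|].
  transitivity (vadd P0 (vsub Z P0)); [vring|].
  rewrite E at 1. generalize (bary1 (vsub Z P0)) (bary2 (vsub Z P0)) (bary3 (vsub Z P0)).
  generalize P1 P2. vring.
Qed.

Lemma in_tet_curve (t : R) : J t -> in_tet P0 P1 P2 P3 (r t).
Proof.
  intros Ht. apply in_tet_intro.
  - apply side_left_nonneg; lra.
  - apply side_right_nonneg; lra.
  - destruct (Req_dec t t0) as [->|]; [right; vring|]. left; apply det_TNr_pos; lra.
  - destruct (Req_dec t t1) as [->|]; [right; vring|]. left; apply det_TNr_neg; lra.
Qed.

(** * Vertices of subtetrahedra stay inside *)

Lemma ttop_spec (a b : R) : J a -> J b -> a <> b ->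
  dt (T b) (N b) (T a) * ttop a b = - dt (T b) (N b) (vsub (r a) (r b)).
Proof.
  intros Ha Hb Hab. assert (H : 0 < dt (T b) (N b) (T a)) by (apply det_TNT_pos; lra).
  unfold ttop. field. split; intro E0; rewrite E0 in H; lra.
Qed.

(** The delicate faces are the two through the chord. For the one containing [T1], the height
    multiplied by [dt T1 (N t1) (T a)] factors by a Pluecker relation. For the one containing [T0],
    the height of [r a] and the step along [T a] have compatible signs only up to the hump; after it
    they compete. *)
Lemma in_tet_tpt_right (a : R) : t0 <= a < t1 -> in_tet P0 P1 P2 P3 (tpt a t1).
Proof.
  intros Ha.
  assert (Hl : 0 < ttop a t1) by (apply ttop_pos; lra).
  assert (Hq : 0 < dt T1 (N t1) (T a)) by (apply det_TNT_pos; lra).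
  pose proof (ttop_spec a t1 ltac:(lra) ltac:(lra) ltac:(lra)) as Hs.
  apply in_tet_intro.
  - assert (E : dt T1 (N t1) (T a) * dt v T1 (vsub (tpt a t1) P0) =
                dt T1 (N t1) v * dt T1 (vsub (r a) P3) (T a)).
    { transitivity (dt T1 (N t1) (T a) * dt v T1 (vsub (r a) P0)
                    + (dt T1 (N t1) (T a) * ttop a t1) * dt v T1 (T a)).
      - unfold tpt; vring.
      - rewrite Hs. vring. }
    assert (0 < dt T1 (vsub (r a) P3) (T a)) by (apply det_TrT_pos; lra).
    assert (H1 : dt T1 (N t1) (vsub P0 P3) < 0) by (apply det_TNr_neg; lra).
    replace (dt T1 (N t1) v) with (- dt T1 (N t1) (vsub P0 P3)) in E by vring. nra.
  - destruct hump_right as (p & Hp & Zp & S1 & S2 & SN).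
    replace (dt v T0 (vsub (tpt a t1) P0)) with
      (dt v T0 (vsub (r a) P0) + ttop a t1 * dt v T0 (T a)) by (unfold tpt; vring).
    pose proof (side_right_nonneg a ltac:(lra)) as Hb.
    destruct (Rle_lt_dec a p) as [L|L].
    + assert (0 <= dt v T0 (T a)).
      { destruct (Req_dec a t0) as [->|]; [right; vring|].
        destruct (Req_dec a p) as [->|]; [lra|]. left; apply S1; lra. }
      nra.
    (* [W] is the wanted height times the positive [dt T1 (N t1) (T a)], after eliminating [ttop].
       As a function of [a] it vanishes at [t1]; in its derivative the terms with [X] cancel, and
       past the hump those with [M] are negative. *)
    + assert (W : 0 < dt v T0 (vsub (r a) P0) * dt T1 (N t1) (T a)
                      - dt T1 (N t1) (vsub (r a) P3) * dt v T0 (T a)).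
      { replace 0 with (dt v T0 (vsub P3 P0) * dt T1 (N t1) T1
                      - dt T1 (N t1) (vsub P3 P3) * dt v T0 T1) by vring.
        apply (decr_of_der (fun s => dt v T0 (vsub (r s) P0) * dt T1 (N t1) (T s)
                      - dt T1 (N t1) (vsub (r s) P3) * dt v T0 (T s))
           (fun s => M s * (dt v T0 (vsub (r s) P0) * dt T1 (N t1) (N s)
                      - dt T1 (N t1) (vsub (r s) P3) * dt v T0 (N s)))); [lra| |].
        - intros s Hs'. eapply der_eq.
          + apply der_minus; apply der_mult; apply der_scal, der_det3; vd.
          + cbv beta. vring.
        - intros s Hs'. assert (0 < M s) by (apply HM; lra).
          assert (0 < dt v T0 (vsub (r s) P0)) by (apply side_right_pos; lra).
          assert (dt T1 (N t1) (N s) < 0) by (apply det_TNN_neg; lra).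
          assert (dt T1 (N t1) (vsub (r s) P3) < 0) by (apply det_TNr_neg; lra).
          assert (dt v T0 (N s) < 0) by (apply SN; lra).
          assert (0 < - dt v T0 (vsub (r s) P0) * dt T1 (N t1) (N s)) by nra.
          assert (0 < dt T1 (N t1) (vsub (r s) P3) * dt v T0 (N s)) by nra.
          nra. }
      left. apply (pos_cancel (dt T1 (N t1) (T a))); [exact Hq|].
      apply (Rlt_le_trans _ _ _ W). right.
      transitivity (dt v T0 (vsub (r a) P0) * dt T1 (N t1) (T a)
                    + (dt T1 (N t1) (T a) * ttop a t1) * dt v T0 (T a)); [rewrite Hs; ring | ring].
  - replace (dt T0 (N t0) (vsub (tpt a t1) P0)) with
      (dt T0 (N t0) (vsub (r a) P0) + ttop a t1 * dt T0 (N t0) (T a)) by (unfold tpt; vring).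
    destruct (Req_dec a t0) as [->|]; [right; vring|].
    assert (0 < dt T0 (N t0) (vsub (r a) P0)) by (apply det_TNr_pos; lra).
    assert (0 < dt T0 (N t0) (T a)) by (apply det_TNT_pos; lra). nra.
  - right. apply tpt_plane; lra.
Qed.

(** The same argument with the ends exchanged: the competing face is now the one containing [T1],
    before its hump, and the auxiliary function starts from zero at [t0]. *)
Lemma in_tet_tpt_left (a : R) : t0 < a <= t1 -> in_tet P0 P1 P2 P3 (tpt a t0).
Proof.
  intros Ha.
  assert (Hl : ttop a t0 < 0) by (apply ttop_neg; lra).
  assert (Hq : 0 < dt T0 (N t0) (T a)) by (apply det_TNT_pos; lra).
  pose proof (ttop_spec a t0 ltac:(lra) ltac:(lra) ltac:(lra)) as Hs.
  apply in_tet_intro.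
  - destruct hump_left as (p & Hp & Zp & S1 & S2 & SN).
    replace (dt v T1 (vsub (tpt a t0) P0)) with
      (dt v T1 (vsub (r a) P0) + ttop a t0 * dt v T1 (T a)) by (unfold tpt; vring).
    pose proof (side_left_nonneg a ltac:(lra)) as Hb.
    destruct (Rle_lt_dec p a) as [L|L].
    + assert (dt v T1 (T a) <= 0).
      { destruct (Req_dec a t1) as [->|]; [right; vring|].
        destruct (Req_dec a p) as [->|]; [lra|]. left; apply S2; lra. }
      nra.
    + assert (W : 0 < dt v T1 (vsub (r a) P0) * dt T0 (N t0) (T a)
                      - dt T0 (N t0) (vsub (r a) P0) * dt v T1 (T a)).
      { replace 0 with (dt v T1 (vsub P0 P0) * dt T0 (N t0) T0
                      - dt T0 (N t0) (vsub P0 P0) * dt v T1 T0) by vring.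
        apply (incr_of_der (fun s => dt v T1 (vsub (r s) P0) * dt T0 (N t0) (T s)
                      - dt T0 (N t0) (vsub (r s) P0) * dt v T1 (T s))
           (fun s => M s * (dt v T1 (vsub (r s) P0) * dt T0 (N t0) (N s)
                      - dt T0 (N t0) (vsub (r s) P0) * dt v T1 (N s)))); [lra| |].
        - intros s Hs'. eapply der_eq.
          + apply der_minus; apply der_mult; apply der_scal, der_det3; vd.
          + cbv beta. vring.
        - intros s Hs'. assert (0 < M s) by (apply HM; lra).
          assert (0 < dt v T1 (vsub (r s) P0)) by (apply side_left_pos; lra).
          assert (0 < dt T0 (N t0) (N s)) by (apply det_TNN_pos; lra).
          assert (0 < dt T0 (N t0) (vsub (r s) P0)) by (apply det_TNr_pos; lra).
          assert (dt v T1 (N s) < 0) by (apply SN; lra).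
          assert (0 < dt v T1 (vsub (r s) P0) * dt T0 (N t0) (N s)) by nra.
          assert (0 < - dt T0 (N t0) (vsub (r s) P0) * dt v T1 (N s)) by nra.
          nra. }
      left. apply (pos_cancel (dt T0 (N t0) (T a))); [exact Hq|].
      apply (Rlt_le_trans _ _ _ W). right.
      transitivity (dt v T1 (vsub (r a) P0) * dt T0 (N t0) (T a)
                    + (dt T0 (N t0) (T a) * ttop a t0) * dt v T1 (T a)); [rewrite Hs; ring | ring].
  - assert (E : dt T0 (N t0) (T a) * dt v T0 (vsub (tpt a t0) P0) =
                dt T0 (N t0) v * dt T0 (vsub (r a) P0) (T a)).
    { transitivity (dt T0 (N t0) (T a) * dt v T0 (vsub (r a) P0)
                    + (dt T0 (N t0) (T a) * ttop a t0) * dt v T0 (T a)).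
      - unfold tpt; vring.
      - rewrite Hs. vring. }
    assert (0 < dt T0 (vsub (r a) P0) (T a)) by (apply det_TrT_pos; lra).
    assert (0 < dt T0 (N t0) v) by (apply det_TNr_pos; lra). nra.
  - right. symmetry. apply tpt_plane; lra.
  - replace (dt T1 (N t1) (vsub (tpt a t0) P3)) with
      (dt T1 (N t1) (vsub (r a) P3) + ttop a t0 * dt T1 (N t1) (T a)) by (unfold tpt; vring).
    destruct (Req_dec a t1) as [->|]; [right; vring|].
    assert (dt T1 (N t1) (vsub (r a) P3) < 0) by (apply det_TNr_neg; lra).
    assert (0 < dt T1 (N t1) (T a)) by (apply det_TNT_pos; lra). nra.
Qed.

(** By monotonicity of [ttop a], the point lies on the segment of the tangent line from [r a] to its
    intersection with the osculating plane at [t1] (if [a < b]) or at [t0] (if [b < a]). Both ends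
    are in the tetrahedron, which is convex. *)
Lemma in_tet_tpt (a b : R) : J a -> J b -> a <> b -> in_tet P0 P1 P2 P3 (tpt a b).
Proof.
  intros Ha Hb Hab.
  assert (S : forall u w, 0 <= u / w <= 1 -> w <> 0 ->
    in_tet P0 P1 P2 P3 (vadd (r a) (vscale w (T a))) ->
    in_tet P0 P1 P2 P3 (vadd (r a) (vscale u (T a)))).
  { intros u w Hu Hw H.
    replace (vadd (r a) (vscale u (T a))) with
      (vadd (vscale (1 - u / w) (r a)) (vscale (u / w) (vadd (r a) (vscale w (T a))))).
    - apply in_tet_convex; [lra | apply in_tet_curve; lra | exact H].
    - apply V3_ext; vunf; field; exact Hw. }
  destruct (Rlt_le_dec a b) as [L|L].
  - assert (0 < ttop a b) by (apply ttop_pos; lra).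
    assert (ttop a b <= ttop a t1).
    { destruct (Req_dec b t1) as [->|]; [right; reflexivity|]. left; apply ttop_incr; lra. }
    apply (S (ttop a b) (ttop a t1)); [| lra | apply in_tet_tpt_right; lra].
    split; [apply div_nonneg; lra|]. apply div_le_1; lra.
  - assert (ttop a b < 0) by (apply ttop_neg; lra).
    assert (ttop a t0 <= ttop a b).
    { destruct (Req_dec b t0) as [->|]; [right; reflexivity|]. left; apply ttop_incr; lra. }
    apply (S (ttop a b) (ttop a t0)); [| lra | apply in_tet_tpt_left; lra].
    rewrite div_opp_opp by lra.
    split; [apply div_nonneg; lra|]. apply div_le_1; lra.
Qed.

(** * Monotonicity of the intersection points on the edges *)

Lemma curve_bary_pos (t : R) : t0 < t < t1 ->
  0 < bary1 (vsub (r t) P0) /\ 0 < bary2 (vsub (r t) P0) /\ 0 < bary3 (vsub (r t) P0) /\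
  0 < 1 - bary1 (vsub (r t) P0) - bary2 (vsub (r t) P0) - bary3 (vsub (r t) P0).
Proof.
  intros Ht. destruct tet_denominators as (H0 & H1 & HD & H2 & H3).
  repeat split.
  - apply Rdiv_lt_0_compat; [apply side_left_pos; lra | apply Rmult_lt_0_compat; lra].
  - apply Rdiv_lt_0_compat; [apply side_right_pos; lra | apply Rmult_lt_0_compat; lra].
  - apply Rdiv_lt_0_compat; [apply det_TNr_pos; lra | lra].
  - rewrite bary0_eq, div_opp_opp by lra.
    replace (vsub (vadd P0 (vsub (r t) P0)) P3) with (vsub (r t) P3) by vring.
    assert (dt T1 (N t1) (vsub (r t) P3) < 0) by (apply det_TNr_neg; lra).
    apply Rdiv_lt_0_compat; lra.
Qed.

Lemma bary3_incr (x y : R) : t0 < x -> x < y -> y < t1 ->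
  bary3 (vsub (r x) P0) < bary3 (vsub (r y) P0).
Proof.
  intros Hx Hxy Hy. destruct tet_denominators as (_ & _ & _ & H2 & _). unfold bary3.
  apply Rmult_lt_compat_r; [apply Rinv_0_lt_compat; lra|].
  apply (incr_of_der (fun t => dt T0 (N t0) (vsub (r t) P0)) (fun t => X t * dt T0 (N t0) (T t)));
    [lra | dd |].
  intros c Hc. apply Rmult_lt_0_compat; [apply HX; lra | apply det_TNT_pos; lra].
Qed.

Lemma bary0_decr (x y : R) : t0 < x -> x < y -> y < t1 ->
  1 - bary1 (vsub (r y) P0) - bary2 (vsub (r y) P0) - bary3 (vsub (r y) P0) <
  1 - bary1 (vsub (r x) P0) - bary2 (vsub (r x) P0) - bary3 (vsub (r x) P0).
Proof.
  intros Hx Hxy Hy. destruct tet_denominators as (_ & _ & _ & _ & H3).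
  rewrite !bary0_eq, !(div_opp_opp _ (dt T1 (N t1) (vsub P0 P3))) by lra.
  apply Rmult_lt_compat_r; [apply Rinv_0_lt_compat; lra|]. apply Ropp_lt_contravar.
  replace (vsub (vadd P0 (vsub (r x) P0)) P3) with (vsub (r x) P3) by vring.
  replace (vsub (vadd P0 (vsub (r y) P0)) P3) with (vsub (r y) P3) by vring.
  apply (incr_of_der (fun t => dt T1 (N t1) (vsub (r t) P3)) (fun t => X t * dt T1 (N t1) (T t)));
    [lra | dd |].
  intros c Hc. apply Rmult_lt_0_compat; [apply HX; lra | apply det_TNT_pos; lra].
Qed.

(** Up to positive constants, coordinates 1 and 2 are the heights above the two chord faces. Their
    Wronskian factors into [X], [dt T0 v T1] and the determinant of [det_rTr_pos]. *)
Lemma bary_ratio12_incr (x y : R) : t0 < x -> x < y -> y < t1 ->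
  bary2 (vsub (r x) P0) * bary1 (vsub (r y) P0) < bary2 (vsub (r y) P0) * bary1 (vsub (r x) P0).
Proof.
  intros Hx Hxy Hy. destruct tet_denominators as (H0 & H1 & HD & _ & _).
  assert (E : dt v T0 (vsub (r x) P0) * dt v T1 (vsub (r y) P0)
              < dt v T0 (vsub (r y) P0) * dt v T1 (vsub (r x) P0)).
  { apply (ratio_incr (fun t => dt v T0 (vsub (r t) P0)) (fun t => dt v T1 (vsub (r t) P0))
      (fun t => X t * dt v T0 (T t)) (fun t => X t * dt v T1 (T t))); [lra | dd | dd | |].
    - intros c Hc; apply side_left_pos; lra.
    - intros c Hc.
      replace (X c * dt v T0 (T c) * dt v T1 (vsub (r c) P0)
               - dt v T0 (vsub (r c) P0) * (X c * dt v T1 (T c)))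
        with (X c * (dt T0 v T1 * dt (vsub (r c) P0) (T c) (vsub P3 (r c)))) by vring.
      apply Rmult_lt_0_compat; [apply HX; lra|].
      apply Rmult_lt_0_compat; [exact HD | apply det_rTr_pos; lra]. }
  unfold bary1, bary2. generalize dependent (dt T0 v T1). intros D HD.
  replace (dt v T0 (vsub (r x) P0) / (- L1 * D) * (dt v T1 (vsub (r y) P0) / (L0 * D)))
    with (dt v T0 (vsub (r x) P0) * dt v T1 (vsub (r y) P0) * / (- L1 * L0 * D * D))
    by (field; lra).
  replace (dt v T0 (vsub (r y) P0) / (- L1 * D) * (dt v T1 (vsub (r x) P0) / (L0 * D)))
    with (dt v T0 (vsub (r y) P0) * dt v T1 (vsub (r x) P0) * / (- L1 * L0 * D * D))
    by (field; lra).
  apply Rmult_lt_compat_r; [|exact E].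
  apply Rinv_0_lt_compat. repeat apply Rmult_lt_0_compat; lra.
Qed.

(** The tangent line at [t0] meets the osculating plane at [t] before it reaches [P1], because
    [ttop t0] increases. With the next lemma, [P1] and [P2] lie strictly on opposite sides of that
    plane. *)
Lemma osc_edge0_pos (t : R) : t0 < t < t1 -> 0 < dt (T t) (N t) (vsub P1 (r t)).
Proof.
  intros Ht.
  assert (Hq : 0 < dt (T t) (N t) T0) by (apply det_TNT_pos; lra).
  pose proof (ttop_spec t0 t ltac:(lra) ltac:(lra) ltac:(lra)) as Hs.
  assert (ttop t0 t < L0) by (apply ttop_incr; lra).
  replace (dt (T t) (N t) (vsub P1 (r t)))
    with (dt (T t) (N t) (vsub P0 (r t)) + L0 * dt (T t) (N t) T0) by (unfold tpt; vring).
  nra.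
Qed.

Lemma osc_edge3_neg (t : R) : t0 < t < t1 -> dt (T t) (N t) (vsub P2 (r t)) < 0.
Proof.
  intros Ht.
  assert (Hq : 0 < dt (T t) (N t) T1) by (apply det_TNT_pos; lra).
  pose proof (ttop_spec t1 t ltac:(lra) ltac:(lra) ltac:(lra)) as Hs.
  assert (L1 < ttop t1 t) by (apply ttop_incr; lra).
  replace (dt (T t) (N t) (vsub P2 (r t)))
    with (dt (T t) (N t) (vsub P3 (r t)) + L1 * dt (T t) (N t) T1) by (unfold tpt; vring).
  nra.
Qed.

(* In barycentric coordinates, [det (T, P1 - r, P2 - r)] is the Wronskian of the coordinates
   0 and 3, which is positive because coordinate 0 decreases and coordinate 3 increases. *)
Lemma tangent_edge_det_pos (t : R) : t0 < t < t1 -> 0 < dt (T t) (vsub P1 (r t)) (vsub P2 (r t)).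
Proof.
  intros Ht. destruct tet_denominators as (_ & _ & _ & H2 & H3).
  destruct (curve_bary_pos t Ht) as (_ & _ & Hb3 & Hb0).
  pose proof tet_volume_pos as HV.
  assert (F3 : 0 < bary3 (T t)).
  { apply Rdiv_lt_0_compat; [apply det_TNT_pos; lra | lra]. }
  (* For a velocity, coordinate 0 is minus the sum of the other three. As [bary0_eq] speaks of
     points, it is applied to [P0 + T t] and the value 1 taken at [P0] is subtracted. *)
  assert (F0 : 0 < bary1 (T t) + bary2 (T t) + bary3 (T t)).
  { pose proof (bary0_eq (T t)) as E.
    assert (0 < dt T1 (N t1) (T t)) by (apply det_TNT_pos; lra).
    replace (dt T1 (N t1) (vsub (vadd P0 (T t)) P3))
      with (dt T1 (N t1) (vsub P0 P3) + dt T1 (N t1) (T t)) in E by vring.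
    assert (E' : 1 - (bary1 (T t) + bary2 (T t) + bary3 (T t)) =
                 1 + dt T1 (N t1) (T t) / dt T1 (N t1) (vsub P0 P3)).
    { transitivity (1 - bary1 (T t) - bary2 (T t) - bary3 (T t)); [ring|].
      rewrite E, Rdiv_plus_distr, Rdiv_diag by lra. reflexivity. }
    rewrite div_opp_opp in E' by lra.
    assert (G : 0 < dt T1 (N t1) (T t) / - dt T1 (N t1) (vsub P0 P3))
      by (apply Rdiv_lt_0_compat; lra).
    rewrite Rdiv_opp_l in E'. lra. }
  pose proof (bary_decomp (T t)) as ET. pose proof (bary_decomp (vsub (r t) P0)) as Er.
  replace (dt (T t) (vsub P1 (r t)) (vsub P2 (r t))) with
    (((1 - bary1 (vsub (r t) P0) - bary2 (vsub (r t) P0) - bary3 (vsub (r t) P0)) * bary3 (T t)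
      + bary3 (vsub (r t) P0) * (bary1 (T t) + bary2 (T t) + bary3 (T t)))
     * dt (vsub P1 P0) (vsub P2 P0) (vsub P3 P0)).
  - apply Rmult_lt_0_compat; [|exact HV].
    apply Rplus_lt_0_compat; apply Rmult_lt_0_compat; lra.
  - replace (vsub P1 (r t)) with (vsub (vsub P1 P0) (vsub (r t) P0)) by vring.
    replace (vsub P2 (r t)) with (vsub (vsub P2 P0) (vsub (r t) P0)) by vring.
    revert ET Er.
    generalize (bary1 (vsub (r t) P0)) (bary2 (vsub (r t) P0)) (bary3 (vsub (r t) P0))
      (bary1 (T t)) (bary2 (T t)) (bary3 (T t)).
    generalize (vsub P1 P0) (vsub P2 P0) v (vsub (r t) P0) (T t).
    intros u1 u2 u3 w z b1 b2 b3 f1 f2 f3 -> ->. vring.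
Qed.

(** Along the curve [dt (T t) (N t) (vsub P (r t))] changes only through [N], since the motions of
    [T] and [r] repeat a column. The Wronskian for [P1] and [P2] factors into [K], the unit
    determinant of the frame and [tangent_edge_det_pos]. *)
Lemma osc_ratio_incr (x y : R) : t0 < x -> x < y -> y < t1 ->
  dt (T x) (N x) (vsub P1 (r x)) * - dt (T y) (N y) (vsub P2 (r y)) <
  dt (T y) (N y) (vsub P1 (r y)) * - dt (T x) (N x) (vsub P2 (r x)).
Proof.
  intros Hx Hxy Hy.
  apply (ratio_incr (fun t => dt (T t) (N t) (vsub P1 (r t)))
    (fun t => - dt (T t) (N t) (vsub P2 (r t)))
    (fun t => K t * dt (T t) e (vsub P1 (r t)))
    (fun t => - (K t * dt (T t) e (vsub P2 (r t))))); [lra | | | |].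
  - generalize P1. dd.
  - generalize P2. intros p2 c Hc. apply der_opp. revert c Hc. dd.
  - intros c Hc. pose proof (osc_edge3_neg c). lra.
  - intros c Hc.
    replace (K c * dt (T c) e (vsub P1 (r c)) * - dt (T c) (N c) (vsub P2 (r c))
       - dt (T c) (N c) (vsub P1 (r c)) * - (K c * dt (T c) e (vsub P2 (r c))))
      with (K c * (dt (T c) (N c) e * dt (T c) (vsub P1 (r c)) (vsub P2 (r c))))
      by (generalize P1 P2; vring).
    rewrite Hd by lra.
    apply Rmult_lt_0_compat; [apply HK; lra|]. rewrite Rmult_1_l.
    apply tangent_edge_det_pos; lra.
Qed.

(* Affine parameters, on their edges, of the points r01, r12, r23 of (Q6) and r03, r12' of (Q7). *)
Definition share01 (t : R) : R := ttop t0 t / L0.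
Definition share12 (t : R) : R :=
  dt (T t) (N t) (vsub P1 (r t)) /
  (dt (T t) (N t) (vsub P1 (r t)) + - dt (T t) (N t) (vsub P2 (r t))).
Definition share23 (t : R) : R := (ttop t1 t - L1) / - L1.
Definition share03 (t : R) : R :=
  bary3 (vsub (r t) P0) / (bary3 (vsub (r t) P0) +
    (1 - bary1 (vsub (r t) P0) - bary2 (vsub (r t) P0) - bary3 (vsub (r t) P0))).
Definition share12' (t : R) : R :=
  bary2 (vsub (r t) P0) / (bary2 (vsub (r t) P0) + bary1 (vsub (r t) P0)).

Lemma share01_spec (t k : R) : t0 < t < t1 ->
  dt (T t) (N t) (vsub (vadd P0 (vscale k (vsub P1 P0))) (r t)) = 0 <-> k = share01 t.
Proof.
  intros Ht. assert (H0 : 0 < L0) by (apply ttop_pos; lra).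
  assert (Hq : 0 < dt (T t) (N t) T0) by (apply det_TNT_pos; lra).
  pose proof (ttop_spec t0 t ltac:(lra) ltac:(lra) ltac:(lra)) as Hs.
  replace (dt (T t) (N t) (vsub (vadd P0 (vscale k (vsub P1 P0))) (r t)))
    with (dt (T t) (N t) T0 * (k * L0) + dt (T t) (N t) (vsub P0 (r t))) by (unfold tpt; vring).
  unfold share01. split; intro E.
  - apply (Rmult_eq_reg_r L0); [|lra]. rewrite div_cancel by lra.
    apply (Rmult_eq_reg_l (dt (T t) (N t) T0)); lra.
  - rewrite E, div_cancel by lra. lra.
Qed.

Lemma share23_spec (t k : R) : t0 < t < t1 ->
  dt (T t) (N t) (vsub (vadd P2 (vscale k (vsub P3 P2))) (r t)) = 0 <-> k = share23 t.
Proof.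
  intros Ht. assert (H0 : L1 < 0) by (apply ttop_neg; lra).
  assert (Hq : 0 < dt (T t) (N t) T1) by (apply det_TNT_pos; lra).
  pose proof (ttop_spec t1 t ltac:(lra) ltac:(lra) ltac:(lra)) as Hs.
  replace (dt (T t) (N t) (vsub (vadd P2 (vscale k (vsub P3 P2))) (r t)))
    with (dt (T t) (N t) T1 * (k * - L1 + L1) + dt (T t) (N t) (vsub P3 (r t)))
    by (unfold tpt; vring).
  unfold share23. split; intro E.
  - apply (Rmult_eq_reg_r (- L1)); [|lra]. rewrite div_cancel by lra.
    apply (Rmult_eq_reg_l (dt (T t) (N t) T1)); lra.
  - rewrite E, div_cancel by lra. lra.
Qed.

Lemma share12_spec (t k : R) : t0 < t < t1 ->
  dt (T t) (N t) (vsub (vadd P1 (vscale k (vsub P2 P1))) (r t)) = 0 <-> k = share12 t.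
Proof.
  intros Ht. pose proof (osc_edge0_pos t Ht). pose proof (osc_edge3_neg t Ht).
  replace (dt (T t) (N t) (vsub (vadd P1 (vscale k (vsub P2 P1))) (r t)))
    with (dt (T t) (N t) (vsub P1 (r t))
          - k * (dt (T t) (N t) (vsub P1 (r t)) + - dt (T t) (N t) (vsub P2 (r t))))
    by (generalize P1 P2; vring).
  unfold share12. split; intro E.
  - apply (Rmult_eq_reg_r (dt (T t) (N t) (vsub P1 (r t)) + - dt (T t) (N t) (vsub P2 (r t))));
      [|lra]. rewrite div_cancel by lra. lra.
  - rewrite E, div_cancel by lra. lra.
Qed.

(** A plane through the edge [P1 P2] fixes the ratio of coordinates 0 and 3, so it cuts [P0 P3] in
    the ratio of these coordinates of [r t]: the determinant is the volume times an affine function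
    of [k]. The next lemma does the same with coordinates 1 and 2. *)
Lemma share03_spec (t k : R) : t0 < t < t1 ->
  in_plane3 P1 P2 (r t) (vadd P0 (vscale k (vsub P3 P0))) <-> k = share03 t.
Proof.
  intros Ht. destruct (curve_bary_pos t Ht) as (_ & _ & Hb3 & Hb0).
  pose proof tet_volume_pos as HV. unfold in_plane3, share03.
  pose proof (bary_decomp (vsub (r t) P0)) as Er.
  assert (E : det3 (vsub P2 P1) (vsub (r t) P1) (vsub (vadd P0 (vscale k (vsub P3 P0))) P1) =
    (k * (bary3 (vsub (r t) P0) +
     (1 - bary1 (vsub (r t) P0) - bary2 (vsub (r t) P0) - bary3 (vsub (r t) P0)))
     - bary3 (vsub (r t) P0)) * det3 (vsub P1 P0) (vsub P2 P0) (vsub P3 P0)).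
  { replace (vsub (r t) P1) with (vsub (vsub (r t) P0) (vsub P1 P0)) by vring.
    revert Er. generalize (bary1 (vsub (r t) P0)) (bary2 (vsub (r t) P0)) (bary3 (vsub (r t) P0)).
    generalize (vsub (r t) P0) P1 P2. intros w p1 p2 b1 b2 b3 ->. vring. }
  rewrite E. split; intro E'.
  - apply Rmult_integral in E' as [E'|E']; [|rewrite E' in HV; lra].
    apply (Rmult_eq_reg_r (bary3 (vsub (r t) P0) +
     (1 - bary1 (vsub (r t) P0) - bary2 (vsub (r t) P0) - bary3 (vsub (r t) P0)))); [|lra].
    rewrite div_cancel by lra. lra.
  - rewrite E', div_cancel by lra. ring.
Qed.

Lemma share12'_spec (t k : R) : t0 < t < t1 ->
  in_plane3 P0 P3 (r t) (vadd P1 (vscale k (vsub P2 P1))) <-> k = share12' t.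
Proof.
  intros Ht. destruct (curve_bary_pos t Ht) as (Hb1 & Hb2 & _ & _).
  pose proof tet_volume_pos as HV. unfold in_plane3, share12'.
  pose proof (bary_decomp (vsub (r t) P0)) as Er.
  assert (E : det3 (vsub P3 P0) (vsub (r t) P0) (vsub (vadd P1 (vscale k (vsub P2 P1))) P0) =
    (k * (bary2 (vsub (r t) P0) + bary1 (vsub (r t) P0)) - bary2 (vsub (r t) P0))
     * det3 (vsub P1 P0) (vsub P2 P0) (vsub P3 P0)).
  { revert Er. generalize (bary1 (vsub (r t) P0)) (bary2 (vsub (r t) P0)) (bary3 (vsub (r t) P0)).
    generalize (vsub (r t) P0) P1 P2. intros w p1 p2 b1 b2 b3 ->. vring. }
  rewrite E. split; intro E'.
  - apply Rmult_integral in E' as [E'|E']; [|rewrite E' in HV; lra].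
    apply (Rmult_eq_reg_r (bary2 (vsub (r t) P0) + bary1 (vsub (r t) P0))); [|lra].
    rewrite div_cancel by lra. lra.
  - rewrite E', div_cancel by lra. ring.
Qed.

Lemma shares_nonneg (t : R) : t0 < t < t1 ->
  0 <= share01 t /\ 0 <= share12 t /\ 0 <= share23 t /\ 0 <= share03 t /\ 0 <= share12' t.
Proof.
  intros Ht. pose proof (osc_edge0_pos t Ht). pose proof (osc_edge3_neg t Ht).
  destruct (curve_bary_pos t Ht) as (? & ? & ? & ?).
  destruct tet_denominators as (? & ? & _).
  assert (0 < ttop t0 t) by (apply ttop_pos; lra).
  assert (L1 < ttop t1 t) by (apply ttop_incr; lra).
  repeat split; apply div_nonneg; lra.
Qed.

Lemma shares_incr (x y : R) : t0 < x -> x < y -> y < t1 ->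
  share01 x < share01 y /\ share12 x < share12 y /\ share23 x < share23 y /\
  share03 x < share03 y /\ share12' x < share12' y.
Proof.
  intros Hx Hxy Hy.
  pose proof (osc_edge0_pos x ltac:(lra)). pose proof (osc_edge3_neg x ltac:(lra)).
  pose proof (osc_edge0_pos y ltac:(lra)). pose proof (osc_edge3_neg y ltac:(lra)).
  destruct (curve_bary_pos x ltac:(lra)) as (? & ? & ? & ?).
  destruct (curve_bary_pos y ltac:(lra)) as (? & ? & ? & ?).
  destruct tet_denominators as (? & ? & _).
  assert (ttop t0 x < ttop t0 y) by (apply ttop_incr; lra).
  assert (ttop t1 x < ttop t1 y) by (apply ttop_incr; lra).
  repeat split.
  - apply Rmult_lt_compat_r; [apply Rinv_0_lt_compat|]; lra.
  - apply share_incr; try lra. apply osc_ratio_incr; assumption.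
  - apply Rmult_lt_compat_r; [apply Rinv_0_lt_compat|]; lra.
  - apply share_incr; try lra.
    pose proof (bary3_incr x y Hx Hxy Hy). pose proof (bary0_decr x y Hx Hxy Hy).
    apply Rmult_le_0_lt_compat; lra.
  - apply share_incr; try lra. apply bary_ratio12_incr; assumption.
Qed.

End Frame.

(** * The Euclidean norm *)

Lemma vnorm_scale (k : R) (u : V3) : vnorm (vscale k u) = Rabs k * vnorm u.
Proof.
  unfold vnorm. replace (dot (vscale k u) (vscale k u)) with (Rsqr k * dot u u)
    by (unfold Rsqr; vring).
  rewrite sqrt_mult_alt by apply Rle_0_sqr. rewrite sqrt_Rsqr_abs. reflexivity.
Qed.

Lemma dot_self_pos (u : V3) : u <> vzero -> 0 < dot u u.
Proof.
  intros H. destruct u as [a b c']. unfold dot; simpl.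
  destruct (Req_dec a 0); [|nra]. destruct (Req_dec b 0); [|nra]. destruct (Req_dec c' 0); [|nra].
  subst. exfalso; apply H; reflexivity.
Qed.

Lemma vnorm_pos (u : V3) : u <> vzero -> 0 < vnorm u.
Proof. intros H. apply sqrt_lt_R0, dot_self_pos, H. Qed.

Lemma vnorm_le_sum (u : V3) : vnorm u <= Rabs (vx u) + Rabs (vy u) + Rabs (vz u).
Proof.
  pose proof (Rabs_pos (vx u)). pose proof (Rabs_pos (vy u)). pose proof (Rabs_pos (vz u)).
  rewrite <- (sqrt_Rsqr (Rabs (vx u) + Rabs (vy u) + Rabs (vz u))) by lra.
  apply sqrt_le_1_alt. unfold dot.
  pose proof (Rsqr_abs (vx u)). pose proof (Rsqr_abs (vy u)). pose proof (Rsqr_abs (vz u)).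
  unfold Rsqr in *. nra.
Qed.

(** * One-sided limits *)

Definition vcont (f : R -> V3) (s : R) : Prop :=
  continuity_pt (fun t => vx (f t)) s /\ continuity_pt (fun t => vy (f t)) s /\
  continuity_pt (fun t => vz (f t)) s.

Lemma vcont_of_der (f : R -> V3) (s : R) (l : V3) : vder f s l -> vcont f s.
Proof.
  intros (? & ? & ?); repeat split; apply derivable_continuous_pt; eexists; eassumption.
Qed.

Lemma vcont_limit (f : R -> V3) (s eps : R) : vcont f s -> 0 < eps ->
  exists del, 0 < del /\ forall t, Rabs (t - s) < del -> vnorm (vsub (f t) (f s)) < eps.
Proof.
  assert (H1 : forall g, continuity_pt g s -> 0 < eps -> exists del, 0 < del /\
            forall t, Rabs (t - s) < del -> Rabs (g t - g s) < eps / 3).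
  { intros g Hg He. destruct (Hg (eps / 3)) as (del & Hd & H); [lra|].
    exists del; split; [exact Hd|]. intros t Ht. destruct (Req_dec t s) as [->|Hne].
    - rewrite Rminus_diag, Rabs_R0. lra.
    - apply H. repeat split; auto. }
  intros (Hx & Hy & Hz) He.
  destruct (H1 _ Hx He) as (d1 & ? & K1). destruct (H1 _ Hy He) as (d2 & ? & K2).
  destruct (H1 _ Hz He) as (d3 & ? & K3).
  exists (Rmin d1 (Rmin d2 d3)). split; [repeat apply Rmin_glb_lt; assumption|].
  intros t Ht. pose proof (Rmin_l d1 (Rmin d2 d3)). pose proof (Rmin_r d1 (Rmin d2 d3)).
  pose proof (Rmin_l d2 d3). pose proof (Rmin_r d2 d3).
  specialize (K1 t ltac:(lra)). specialize (K2 t ltac:(lra)). specialize (K3 t ltac:(lra)).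
  pose proof (vnorm_le_sum (vsub (f t) (f s))) as Hn. simpl in Hn. lra.
Qed.

(** [alpha] and [gamma] carry no information where [r'] or its cross product with [r''] vanishes.
    Their one-sided limits are obtained as values of a continuous [g] that agrees with them only
    beside [s]. *)
Lemma lim_right_intro (f g : R -> V3) (s b : R) :
  s < b -> (forall t, s < t < b -> f t = g t) -> vcont g s -> lim_right f s (g s).
Proof.
  intros Hb Hfg Hg eps He. destruct (vcont_limit g s eps Hg He) as (del & Hd & H).
  exists (Rmin del (b - s)). split; [apply Rlt_gt, Rmin_glb_lt; lra|].
  intros t Ht. pose proof (Rmin_l del (b - s)). pose proof (Rmin_r del (b - s)).
  rewrite Hfg by lra. apply H. rewrite Rabs_pos_eq; lra.
Qed.

Lemma lim_left_intro (f g : R -> V3) (s a : R) :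
  a < s -> (forall t, a < t < s -> f t = g t) -> vcont g s -> lim_left f s (g s).
Proof.
  intros Hb Hfg Hg eps He. destruct (vcont_limit g s eps Hg He) as (del & Hd & H).
  exists (Rmin del (s - a)). split; [apply Rlt_gt, Rmin_glb_lt; lra|].
  intros t Ht. pose proof (Rmin_l del (s - a)). pose proof (Rmin_r del (s - a)).
  rewrite Hfg by lra. apply H. rewrite Rabs_left; lra.
Qed.

Lemma vnorm_ge_comp (u : V3) : Rabs (vx u) <= vnorm u /\ Rabs (vy u) <= vnorm u /\ Rabs (vz u) <= vnorm u.
Proof.
  unfold vnorm, dot. rewrite <- !sqrt_Rsqr_abs. unfold Rsqr.
  repeat split; apply sqrt_le_1_alt; nra.
Qed.

Lemma close_eq (u w : V3) :
  (forall eps, eps > 0 -> exists y, vnorm (vsub y u) < eps /\ vnorm (vsub y w) < eps) -> u = w.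
Proof.
  intros H.
  assert (G : forall p : V3 -> R, (forall x y, p (vsub x y) = p x - p y) ->
     (forall x, Rabs (p x) <= vnorm x) -> p u = p w).
  { intros p Hp Hn. apply Rminus_diag_uniq. destruct (Req_dec (p u - p w) 0) as [E|E]; [exact E|].
    apply Rabs_pos_lt in E. destruct (H (Rabs (p u - p w) / 2)) as (y & H1 & H2); [lra|].
    pose proof (Hn (vsub y u)) as N1. pose proof (Hn (vsub y w)) as N2. rewrite Hp in N1, N2.
    replace (p u - p w) with ((p y - p w) - (p y - p u)) in * by ring.
    pose proof (Rabs_triang (p y - p w) (- (p y - p u))) as Ht. rewrite Rabs_Ropp in Ht.
    unfold Rminus in *. lra. }
  apply V3_ext; apply G; try reflexivity; intros x; apply vnorm_ge_comp.
Qed.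

Lemma lim_right_unique (f : R -> V3) (s : R) (u w : V3) :
  lim_right f s u -> lim_right f s w -> u = w.
Proof.
  intros Hu Hw. apply close_eq. intros eps He.
  destruct (Hu eps He) as (d1 & ? & H1). destruct (Hw eps He) as (d2 & ? & H2).
  pose proof (Rmin_l d1 d2). pose proof (Rmin_r d1 d2).
  assert (0 < Rmin d1 d2) by (apply Rmin_glb_lt; lra).
  exists (f (s + Rmin d1 d2 / 2)). split; [apply H1 | apply H2]; lra.
Qed.

Lemma lim_left_unique (f : R -> V3) (s : R) (u w : V3) :
  lim_left f s u -> lim_left f s w -> u = w.
Proof.
  intros Hu Hw. apply close_eq. intros eps He.
  destruct (Hu eps He) as (d1 & ? & H1). destruct (Hw eps He) as (d2 & ? & H2).
  pose proof (Rmin_l d1 d2). pose proof (Rmin_r d1 d2).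
  assert (0 < Rmin d1 d2) by (apply Rmin_glb_lt; lra).
  exists (f (s - Rmin d1 d2 / 2)). split; [apply H1 | apply H2]; lra.
Qed.

Definition unit_of (u : V3) : V3 := vscale (/ vnorm u) u.

Lemma vcont_unit_of (f : R -> V3) (s : R) :
  vcont f s -> f s <> vzero -> vcont (fun t => unit_of (f t)) s.
Proof.
  intros (Hx & Hy & Hz) H0.
  assert (Hn : continuity_pt (fun t => / vnorm (f t)) s).
  { apply (continuity_pt_inv (fun t => vnorm (f t))).
    - apply (continuity_pt_comp (fun t => dot (f t) (f t)) sqrt).
      + apply (continuity_pt_plus (fun t => vx (f t) * vx (f t) + vy (f t) * vy (f t))
          (fun t => vz (f t) * vz (f t))).
        * apply (continuity_pt_plus (fun t => vx (f t) * vx (f t)) (fun t => vy (f t) * vy (f t)));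
            [exact (continuity_pt_mult _ _ _ Hx Hx) | exact (continuity_pt_mult _ _ _ Hy Hy)].
        * exact (continuity_pt_mult _ _ _ Hz Hz).
      + apply continuity_pt_sqrt. left; apply dot_self_pos, H0.
    - apply Rgt_not_eq, vnorm_pos, H0. }
  repeat split; simpl.
  - exact (continuity_pt_mult _ _ _ Hn Hx).
  - exact (continuity_pt_mult _ _ _ Hn Hy).
  - exact (continuity_pt_mult _ _ _ Hn Hz).
Qed.

Lemma unit_of_scale (k : R) (u : V3) : 0 < k -> u <> vzero -> unit_of (vscale k u) = unit_of u.
Proof.
  intros Hk Hu. pose proof (vnorm_pos u Hu). unfold unit_of. rewrite vnorm_scale, Rabs_pos_eq by lra.
  apply V3_ext; simpl; field; lra.
Qed.

(** The equivalence with [k = s t] supplies existence and uniqueness of the intersection at once. As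
    [s] is nonnegative, the distance from [A] is [s t] times the edge length, so it inherits the
    monotonicity of [s]. *)
Lemma meet_family (A B : V3) (Pl : R -> V3 -> Prop) (s : R -> R) (a b : R) :
  A <> B ->
  (forall t k, a < t < b -> Pl t (vadd A (vscale k (vsub B A))) <-> k = s t) ->
  (forall t, a < t < b -> 0 <= s t) ->
  (forall x y, a < x -> x < y -> y < b -> s x < s y) ->
  (forall t, a < t < b -> unique_meet A B (Pl t) (vadd A (vscale (s t) (vsub B A)))) /\
  strict_mono_on a b (fun t => vnorm (vsub (vadd A (vscale (s t) (vsub B A))) A)).
Proof.
  intros HAB HP Hs Hi. split.
  - intros t Ht. split; [|split].
    + exists (s t); reflexivity.
    + apply HP; trivial.
    + intros Y (k & ->) HY. apply HP in HY; trivial. rewrite HY; reflexivity.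
  - left. intros x y Hx Hxy Hy.
    assert (E : forall k, vsub (vadd A (vscale k (vsub B A))) A = vscale k (vsub B A)) by vring.
    rewrite !E, !vnorm_scale, !Rabs_pos_eq by (apply Hs; lra).
    apply Rmult_lt_compat_r; [|apply Hi; lra].
    apply vnorm_pos. intro E0. apply HAB.
    apply (f_equal vx) in E0 as Ex. apply (f_equal vy) in E0 as Ey. apply (f_equal vz) in E0 as Ez.
    simpl in Ex, Ey, Ez. apply V3_ext; lra.
Qed.

(** * From a frame to a quasi-cubic segment *)

Section FramedCurve.
Context (c : curve) (t0 t1 : R) (T N : R -> V3) (e : V3) (X M K : R -> R) (d : R).
Context (F : frame t0 t1 (pt c) T N e X M K d).
Context (Hr1 : forall t, t0 < t < t1 -> r1 c t = vscale (X t) (T t)).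
Context (Hr2 : forall t, t0 < t < t1 ->
  cross (r1 c t) (r2 c t) = vscale (X t * X t * M t) (cross (T t) (N t))).

Local Notation dt u v w := (d * det3 u v w).
Local Notation J t := (t0 <= t <= t1).
Local Notation S := (tpt (pt c) T N d).
Local Notation L := (ttop (pt c) T N d).
Local Notation binormal t := (cross (T t) (N t)).

Let HX := fr_X _ _ _ _ _ _ _ _ _ _ F.
Let HM := fr_M _ _ _ _ _ _ _ _ _ _ F.
Let Hd := fr_d _ _ _ _ _ _ _ _ _ _ F.
Let Hlt := fr_lt _ _ _ _ _ _ _ _ _ _ F.
Let HTNT := det_TNT_pos _ _ _ _ _ _ _ _ _ _ F.

Lemma frame_d_neq : d <> 0.
Proof. intro E. pose proof (Hd t0 ltac:(lra)). rewrite E in H. lra. Qed.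

Lemma tangent_neq (t : R) : J t -> T t <> vzero.
Proof.
  intros Ht E. pose proof (Hd t Ht) as H. rewrite E in H.
  replace (d * det3 vzero (N t) e) with 0 in H by vring. lra.
Qed.

Lemma binormal_neq (t : R) : J t -> binormal t <> vzero.
Proof.
  intros Ht E. pose proof (Hd t Ht) as H.
  replace (det3 (T t) (N t) e) with (dot (binormal t) e) in H by vring. rewrite E in H.
  replace (d * dot vzero e) with 0 in H by vring. lra.
Qed.

Lemma alpha_eq (t : R) : t0 < t < t1 -> alpha c t = unit_of (T t).
Proof.
  intros Ht. change (alpha c t) with (unit_of (r1 c t)). rewrite Hr1 by exact Ht.
  apply unit_of_scale; [apply HX; lra | apply tangent_neq; lra].
Qed.

Lemma gamma_eq (t : R) : t0 < t < t1 -> gamma c t = unit_of (binormal t).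
Proof.
  intros Ht. change (gamma c t) with (unit_of (cross (r1 c t) (r2 c t))). rewrite Hr2 by exact Ht.
  pose proof (HX t Ht). pose proof (HM t Ht).
  apply unit_of_scale; [|apply binormal_neq; lra].
  apply Rmult_lt_0_compat; [nra | assumption].
Qed.

Lemma vcont_alpha (t : R) : J t -> vcont (fun s => unit_of (T s)) t.
Proof.
  intros Ht. apply vcont_unit_of; [|apply tangent_neq; lra].
  eapply vcont_of_der, (fr_T _ _ _ _ _ _ _ _ _ _ F); lra.
Qed.

Lemma vcont_gamma (t : R) : J t -> vcont (fun s => unit_of (binormal s)) t.
Proof.
  intros Ht. apply vcont_unit_of; [|apply binormal_neq; lra].
  eapply vcont_of_der, vder_cross;
    [apply (fr_T _ _ _ _ _ _ _ _ _ _ F) | apply (fr_N _ _ _ _ _ _ _ _ _ _ F)]; lra.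
Qed.

Lemma alpha_right (a : R) : t0 <= a < t1 -> lim_right (alpha c) a (unit_of (T a)).
Proof.
  intros Ha. apply (lim_right_intro _ (fun s => unit_of (T s)) a t1); [lra | |apply vcont_alpha; lra].
  intros; apply alpha_eq; lra.
Qed.

Lemma gamma_right (a : R) : t0 <= a < t1 -> lim_right (gamma c) a (unit_of (binormal a)).
Proof.
  intros Ha.
  apply (lim_right_intro _ (fun s => unit_of (binormal s)) a t1); [lra | |apply vcont_gamma; lra].
  intros; apply gamma_eq; lra.
Qed.

Lemma alpha_left (b : R) : t0 < b <= t1 -> lim_left (alpha c) b (unit_of (T b)).
Proof.
  intros Ha. apply (lim_left_intro _ (fun s => unit_of (T s)) b t0); [lra | |apply vcont_alpha; lra].
  intros; apply alpha_eq; lra.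
Qed.

Lemma gamma_left (b : R) : t0 < b <= t1 -> lim_left (gamma c) b (unit_of (binormal b)).
Proof.
  intros Ha.
  apply (lim_left_intro _ (fun s => unit_of (binormal s)) b t0); [lra | |apply vcont_gamma; lra].
  intros; apply gamma_eq; lra.
Qed.

Lemma in_plane_binormal (t : R) (P Y : V3) : J t ->
  in_plane P (unit_of (binormal t)) Y <-> dt (T t) (N t) (vsub Y P) = 0.
Proof.
  intros Ht. pose proof (vnorm_pos _ (binormal_neq t Ht)) as Hn. pose proof frame_d_neq.
  assert (E : dot (vsub Y P) (unit_of (binormal t)) =
              / vnorm (binormal t) * det3 (T t) (N t) (vsub Y P))
    by (unfold unit_of; generalize (/ vnorm (binormal t)); vring).
  assert (/ vnorm (binormal t) <> 0) by (apply Rinv_neq_0_compat; lra).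
  unfold in_plane. rewrite E. split; intro H1.
  - apply Rmult_integral in H1 as [H1|H1]; [contradiction|]. rewrite H1; ring.
  - apply Rmult_integral in H1 as [H1|H1]; [contradiction|]. rewrite H1; ring.
Qed.

(** The tangent line at [a] is transversal to the osculating plane at [b] by [det_TNT_pos]; this
    gives the uniqueness clauses of [assoc_tet]. *)
Lemma tangent_line_meet (a b : R) (Y : V3) : J a -> J b -> a <> b ->
  on_line (pt c a) (unit_of (T a)) Y -> dt (T b) (N b) (vsub Y (pt c b)) = 0 -> Y = S a b.
Proof.
  intros Ha Hb Hab (k & ->) H.
  assert (Hq := HTNT a b Ha Hb Hab).
  pose proof (ttop_spec _ _ _ _ _ _ _ _ _ _ F a b Ha Hb Hab) as Hs.
  unfold tpt, unit_of in *.
  assert (E : k * / vnorm (T a) = L a b).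
  { apply (Rmult_eq_reg_l (dt (T b) (N b) (T a))); [|lra]. rewrite Hs.
    revert H. generalize (/ vnorm (T a)). intros w H. rewrite <- (Rplus_0_l (- _)), <- H. vring. }
  rewrite <- E. vring.
Qed.

Lemma on_tangent_line (a b : R) : J a -> on_line (pt c a) (unit_of (T a)) (S a b).
Proof.
  intros Ha. exists (L a b * vnorm (T a)). pose proof (vnorm_pos _ (tangent_neq a Ha)).
  unfold tpt, unit_of. apply V3_ext; simpl; field; lra.
Qed.

Lemma own_plane (a b : R) : dt (T a) (N a) (vsub (S a b) (pt c a)) = 0.
Proof. unfold tpt. vring. Qed.

Lemma assoc_tet_frame (a b : R) : t0 <= a -> a < b -> b <= t1 ->
  assoc_tet c a b (pt c a) (S a b) (S b a) (pt c b).
Proof.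
  intros Ha Hab Hb.
  exists (unit_of (T a)), (unit_of (binormal a)), (unit_of (T b)), (unit_of (binormal b)).
  split; [apply alpha_right; lra|]. split; [apply gamma_right; lra|].
  split; [apply alpha_left; lra|]. split; [apply gamma_left; lra|].
  split; [reflexivity|]. split; [reflexivity|]. split; [|split; [|split]].
  - intro E. assert (Hq := HTNT b a ltac:(lra) ltac:(lra) ltac:(lra)).
    pose proof (Hd b ltac:(lra)) as Hdb.
    pose proof (vnorm_pos _ (binormal_neq a ltac:(lra))) as Na.
    pose proof (vnorm_pos _ (binormal_neq b ltac:(lra))) as Nb.
    (* Pairing with [cross (T b) e] and using Lagrange's identity leaves one product, because the
       binormal at [b] is orthogonal to [T b]; both of its factors are nonzero. *)
    assert (E1 : dot (cross (unit_of (binormal a)) (unit_of (binormal b))) (cross (T b) e) =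
      / vnorm (binormal a) * / vnorm (binormal b) *
       (det3 (T a) (N a) (T b) * det3 (T b) (N b) e)).
    { unfold unit_of. generalize (/ vnorm (binormal a)) (/ vnorm (binormal b)). vring. }
    rewrite E in E1. replace (dot vzero (cross (T b) e)) with 0 in E1 by vring.
    assert (0 < / vnorm (binormal a) * / vnorm (binormal b))
      by (apply Rmult_lt_0_compat; apply Rinv_0_lt_compat; lra).
    symmetry in E1. apply Rmult_integral in E1 as [E1|E1]; [lra|].
    apply Rmult_integral in E1 as [E1|E1]; rewrite E1 in *; lra.
  - split; [apply on_tangent_line; lra|].
    split; [apply in_plane_binormal; [lra | apply own_plane]|].
    split; [apply in_plane_binormal; [lra | apply (tpt_plane _ _ _ _ _ _ _ _ _ _ F); lra]|].
    intros Y HY _ H2. apply in_plane_binormal in H2; [|lra].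
    apply tangent_line_meet; trivial; lra.
  - split; [apply on_tangent_line; lra|].
    split; [apply in_plane_binormal; [lra | apply (tpt_plane _ _ _ _ _ _ _ _ _ _ F); lra]|].
    split; [apply in_plane_binormal; [lra | apply own_plane]|].
    intros Y HY H1 _. apply in_plane_binormal in H1; [|lra].
    apply tangent_line_meet; trivial; lra.
  (* Replacing the chord by the difference of the two middle vertices adds multiples of [T a] and
     [T b] only, so the determinant is unchanged and the vertices differ. *)
  - intro E. pose proof (det_TrT_pos _ _ _ _ _ _ _ _ _ _ F a b ltac:(lra) ltac:(lra) ltac:(lra)) as H.
    replace (dt (T a) (vsub (pt c b) (pt c a)) (T b)) with (dt (T a) (vsub (S b a) (S a b)) (T b)) in H
      by (unfold tpt; vring).
    rewrite E in H. replace (dt (T a) (vsub (S b a) (S b a)) (T b)) with 0 in H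
      by (generalize (S b a); vring). lra.
Qed.

Lemma curvature_frame_neq (t : R) : t0 < t < t1 -> curvature c t <> 0.
Proof.
  intros Ht. pose proof (HX t Ht). pose proof (HM t Ht). unfold curvature.
  rewrite Hr2, Hr1, !vnorm_scale by exact Ht.
  pose proof (vnorm_pos _ (binormal_neq t ltac:(lra))).
  pose proof (vnorm_pos _ (tangent_neq t ltac:(lra))).
  assert (0 < X t * X t * M t) by (apply Rmult_lt_0_compat; nra).
  rewrite !Rabs_pos_eq by lra.
  apply Rgt_not_eq, Rdiv_lt_0_compat; [|apply pow_lt]; apply Rmult_lt_0_compat; assumption.
Qed.

Lemma torsion_frame_neq (t : R) : t0 < t < t1 ->
  det3 (r1 c t) (r2 c t) (r3 c t) <> 0 -> torsion c t <> 0.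
Proof.
  intros Ht H3. pose proof (HX t Ht). pose proof (HM t Ht). unfold torsion.
  rewrite Hr2, vnorm_scale by exact Ht.
  pose proof (vnorm_pos _ (binormal_neq t ltac:(lra))).
  assert (0 < X t * X t * M t) by (apply Rmult_lt_0_compat; nra).
  rewrite Rabs_pos_eq by lra.
  apply Rmult_integral_contrapositive; split; [exact H3|].
  apply Rinv_neq_0_compat, pow_nonzero, Rgt_not_eq, Rmult_lt_0_compat; assumption.
Qed.

(** [k] orients and scales the normal so that the height [g] is a single positive hump with top at
    [p]. The distance to the plane is a fixed positive multiple of [g], and the sign of [k] decides
    on which side of the plane the segment lies. *)
Lemma Q8_frame (n : V3) (k p : R) :
  dot n (vsub (pt c t1) (pt c t0)) = 0 -> t0 < p < t1 -> dot n (T p) = 0 ->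
  (forall t, t0 < t < p -> 0 < k * dot n (T t)) ->
  (forall t, p < t < t1 -> k * dot n (T t) < 0) ->
  Q8_plane c t0 t1 (pt c t0) n.
Proof.
  intros H1 Hp Zp Sl Sr.
  set (g t := k * dot n (vsub (pt c t) (pt c t0))).
  assert (Hk : k <> 0) by (intro E; specialize (Sl ((t0 + p) / 2) ltac:(lra)); rewrite E in Sl; lra).
  assert (Hn : 0 < vnorm n).
  { apply vnorm_pos. intro E. specialize (Sl ((t0 + p) / 2) ltac:(lra)). rewrite E in Sl.
    replace (dot vzero (T ((t0 + p) / 2))) with 0 in Sl by vring. lra. }
  assert (Dg : forall t, J t -> derivable_pt_lim g t (X t * (k * dot n (T t)))).
  { intros t Ht. eapply der_eq.
    - apply der_scal, der_dot; [apply vder_const|].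
      apply vder_sub; [apply (fr_r _ _ _ _ _ _ _ _ _ _ F); lra | apply vder_const].
    - vring. }
  assert (g0 : g t0 = 0) by (unfold g; vring).
  assert (g1 : g t1 = 0) by (unfold g; rewrite H1; ring).
  assert (Gl : forall x y, t0 <= x -> x < y -> y <= p -> g x < g y).
  { intros x y Hx Hxy Hy. apply (incr_of_der g (fun t => X t * (k * dot n (T t)))); trivial.
    - intros t Ht. apply Dg; lra.
    - intros t Ht. apply Rmult_lt_0_compat; [apply HX | apply Sl]; lra. }
  assert (Gr : forall x y, p <= x -> x < y -> y <= t1 -> g y < g x).
  { intros x y Hx Hxy Hy. apply (decr_of_der g (fun t => X t * (k * dot n (T t)))); trivial.
    - intros t Ht. apply Dg; lra.
    - intros t Ht. pose proof (HX t ltac:(lra)). pose proof (Sr t ltac:(lra)). nra. }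
  assert (Gmax : forall s, J s -> s <> p -> g s < g p).
  { intros s Hs Hne. destruct (Rlt_le_dec s p); [apply Gl | apply Gr]; lra. }
  assert (Gpos : forall s, J s -> 0 <= g s).
  { intros s Hs. destruct (Rle_lt_dec s p).
    - rewrite <- g0. destruct (Req_dec s t0) as [->|]; [lra|]. left; apply Gl; lra.
    - rewrite <- g1. destruct (Req_dec s t1) as [->|]; [lra|]. left; apply Gr; lra. }
  assert (Dist : forall s, J s ->
    dist_plane (pt c t0) n (pt c s) = g s * / (Rabs k * vnorm n)).
  { intros s Hs. unfold dist_plane. rewrite <- (Rabs_pos_eq (g s)) by auto.
    unfold g. rewrite Rabs_mult. field. split; [lra | apply Rabs_no_R0, Hk]. }
  assert (Hkn : 0 < / (Rabs k * vnorm n)).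
  { apply Rinv_0_lt_compat, Rmult_lt_0_compat; [apply Rabs_pos_lt, Hk | exact Hn]. }
  split; [|split; [|split]].
  - destruct (Rlt_le_dec 0 k) as [Kp|Kn].
    + left. intros s Hs. specialize (Gpos s Hs). unfold g in Gpos. nra.
    + right. intros s Hs. specialize (Gpos s Hs). unfold g in Gpos. nra.
  - vring.
  - unfold in_plane. rewrite <- H1. vring.
  - exists p. split; [split; [exact Hp|]|split; [|split]].
    + unfold parallel_dir. rewrite Hr1 by lra. rewrite <- (Rmult_0_r (X p)), <- Zp. vring.
    + intros t' Ht' H'. unfold parallel_dir in H'. rewrite Hr1 in H' by lra.
      replace (dot n (vscale (X t') (T t'))) with (X t' * dot n (T t')) in H' by vring.
      pose proof (HX t' Ht'). apply Rmult_integral in H' as [H'|H']; [lra|].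
      destruct (Rtotal_order t' p) as [L'|[E|G']]; [|exact E|].
      * specialize (Sl t' ltac:(lra)). rewrite H' in Sl; lra.
      * specialize (Sr t' ltac:(lra)). rewrite H' in Sr; lra.
    + intros s Hs. rewrite !Dist by lra. apply Rmult_le_compat_r; [lra|].
      destruct (Req_dec s p) as [->|Hne]; [lra|]. left; apply Gmax; assumption.
    + intros s Hs E. rewrite !Dist in E by lra. apply Rmult_eq_reg_r in E; [|lra].
      destruct (Req_dec s p) as [|Hne]; [assumption|]. specialize (Gmax s Hs Hne). lra.
Qed.

Lemma quasi_cubic_of_frame :
  (forall t, t0 < t < t1 -> ~ singular c t) ->
  (forall t, t0 < t < t1 -> det3 (r1 c t) (r2 c t) (r3 c t) <> 0) ->
  quasi_cubic c t0 t1.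
Proof.
  intros Hsing H3. split; [exact Hlt|].
  exists (pt c t0), (S t0 t1), (S t1 t0), (pt c t1).
  assert (L0 : 0 < L t0 t1) by (apply (ttop_pos _ _ _ _ _ _ _ _ _ _ F); lra).
  assert (L1 : L t1 t0 < 0) by (apply (ttop_neg _ _ _ _ _ _ _ _ _ _ F); lra).
  pose proof (tet_volume_pos _ _ _ _ _ _ _ _ _ _ F) as HV.
  assert (Osc : forall t P k u, t0 < t < t1 ->
    osc c t (vadd P (vscale k u)) <-> dt (T t) (N t) (vsub (vadd P (vscale k u)) (pt c t)) = 0).
  { intros t P k u Ht. unfold osc. rewrite gamma_eq by exact Ht. apply in_plane_binormal; lra. }
  assert (D01 : pt c t0 <> S t0 t1).
  { intro E. rewrite <- E in HV at 1. revert HV. generalize (S t1 t0). intros q HV.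
    replace (dt (vsub (pt c t0) (pt c t0)) (vsub q (pt c t0)) (vsub (pt c t1) (pt c t0)))
      with 0 in HV by vring. lra. }
  assert (D12 : S t0 t1 <> S t1 t0).
  { intro E. rewrite <- E in HV. revert HV. generalize (S t0 t1). intros q HV.
    replace (dt (vsub q (pt c t0)) (vsub q (pt c t0)) (vsub (pt c t1) (pt c t0)))
      with 0 in HV by vring. lra. }
  assert (D23 : S t1 t0 <> pt c t1).
  { intro E. rewrite E in HV. revert HV. generalize (S t0 t1). intros q HV.
    replace (dt (vsub q (pt c t0)) (vsub (pt c t1) (pt c t0)) (vsub (pt c t1) (pt c t0)))
      with 0 in HV by vring. lra. }
  assert (D03 : pt c t0 <> pt c t1).
  { intro E. rewrite <- E in HV. revert HV. generalize (S t0 t1) (S t1 t0). intros q q' HV.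
    replace (dt (vsub q (pt c t0)) (vsub q' (pt c t0)) (vsub (pt c t0) (pt c t0)))
      with 0 in HV by vring. lra. }
  pose proof (shares_nonneg _ _ _ _ _ _ _ _ _ _ F) as Hs.
  pose proof (shares_incr _ _ _ _ _ _ _ _ _ _ F) as Hi.
  destruct (meet_family _ _ (osc c) (share01 t0 t1 (pt c) T N d) t0 t1 D01) as (A01 & B01).
  { intros t k Ht. rewrite Osc by exact Ht. apply (share01_spec _ _ _ _ _ _ _ _ _ _ F); lra. }
  { intros t Ht. apply Hs, Ht. } { intros x y ? ? ?. apply Hi; assumption. }
  destruct (meet_family _ _ (osc c) (share12 t0 t1 (pt c) T N d) t0 t1 D12) as (A12 & B12).
  { intros t k Ht. rewrite Osc by exact Ht. apply (share12_spec _ _ _ _ _ _ _ _ _ _ F); lra. }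
  { intros t Ht. apply Hs, Ht. } { intros x y ? ? ?. apply Hi; assumption. }
  destruct (meet_family _ _ (osc c) (share23 t0 t1 (pt c) T N d) t0 t1 D23) as (A23 & B23).
  { intros t k Ht. rewrite Osc by exact Ht. apply (share23_spec _ _ _ _ _ _ _ _ _ _ F); lra. }
  { intros t Ht. apply Hs, Ht. } { intros x y ? ? ?. apply Hi; assumption. }
  destruct (meet_family _ _ (fun t => in_plane3 (S t0 t1) (S t1 t0) (pt c t))
    (share03 t0 t1 (pt c) T N d) t0 t1 D03) as (A03 & B03).
  { intros t k Ht. apply (share03_spec _ _ _ _ _ _ _ _ _ _ F); lra. }
  { intros t Ht. apply Hs, Ht. } { intros x y ? ? ?. apply Hi; assumption. }
  destruct (meet_family _ _ (fun t => in_plane3 (pt c t0) (pt c t1) (pt c t))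
    (share12' t0 t1 (pt c) T N d) t0 t1 D12) as (A12' & B12').
  { intros t k Ht. apply (share12'_spec _ _ _ _ _ _ _ _ _ _ F); lra. }
  { intros t Ht. apply Hs, Ht. } { intros x y ? ? ?. apply Hi; assumption. }
  split; [apply assoc_tet_frame; lra|].
  split; [intro E; rewrite E in HV; lra|].
  split.
  { intros al Hal. rewrite (lim_right_unique _ _ _ _ Hal (alpha_right t0 ltac:(lra))).
    unfold parallel, tpt, unit_of. vring. }
  split.
  { intros ar Har. rewrite (lim_left_unique _ _ _ _ Har (alpha_left t1 ltac:(lra))).
    unfold parallel, tpt, unit_of. vring. }
  split.
  { intros gl Hgl. rewrite (lim_right_unique _ _ _ _ Hgl (gamma_right t0 ltac:(lra))).
    repeat split; apply in_plane_binormal; try lra; [vring | apply own_plane |].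
    apply (tpt_plane _ _ _ _ _ _ _ _ _ _ F); lra. }
  split.
  { intros gr Hgr. rewrite (lim_left_unique _ _ _ _ Hgr (gamma_left t1 ltac:(lra))).
    repeat split; apply in_plane_binormal; try lra; [| apply own_plane | vring].
    apply (tpt_plane _ _ _ _ _ _ _ _ _ _ F); lra. }
  split; [exact (in_tet_curve _ _ _ _ _ _ _ _ _ _ F)|].
  split; [exact Hsing|].
  split; [intros t Ht; split; [apply curvature_frame_neq | apply torsion_frame_neq]; auto|].
  split.
  { intros a b Ha Hab Hb. exists (pt c a), (S a b), (S b a), (pt c b).
    split; [apply assoc_tet_frame; lra|].
    repeat split; (apply (in_tet_curve _ _ _ _ _ _ _ _ _ _ F)
      || apply (in_tet_tpt _ _ _ _ _ _ _ _ _ _ F)); lra. }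
  split.
  { eexists _, _, _. split; [intros t Ht; split; [|split]; [apply A01 | apply A12 | apply A23]; exact Ht|].
    split; [exact B01 | split; [exact B12 | exact B23]]. }
  split.
  { eexists _, _. split; [intros t Ht; split; [apply A03 | apply A12']; exact Ht|].
    split; [exact B03 | exact B12']. }
  split.
  - destruct (hump_left _ _ _ _ _ _ _ _ _ _ F) as (p & Hp & Zp & Sl & Sr & _).
    assert (E : forall Y, d * dot (cross (vsub (S t1 t0) (pt c t0)) (vsub (pt c t1) (pt c t0))) Y =
      - L t1 t0 * dt (vsub (pt c t1) (pt c t0)) (T t1) Y) by (unfold tpt; vring).
    apply (Q8_frame _ d p); trivial.
    + unfold tpt; vring.
    + apply (Rmult_eq_reg_l d); [|exact frame_d_neq]. rewrite E, Zp; ring.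
    + intros t Ht. rewrite E. specialize (Sl t ltac:(lra)). nra.
    + intros t Ht. rewrite E. specialize (Sr t ltac:(lra)). nra.
  - destruct (hump_right _ _ _ _ _ _ _ _ _ _ F) as (p & Hp & Zp & Sl & Sr & _).
    assert (E : forall Y, d * dot (cross (vsub (S t0 t1) (pt c t0)) (vsub (pt c t1) (pt c t0))) Y =
      - L t0 t1 * dt (vsub (pt c t1) (pt c t0)) (T t0) Y) by (unfold tpt; vring).
    (* The orienting factor is [- d] here and [d] for the other face because [L t0 t1] is positive
       while [L t1 t0] is negative. *)
    apply (Q8_frame _ (- d) p); trivial.
    + unfold tpt; vring.
    + apply (Rmult_eq_reg_l d); [|exact frame_d_neq]. rewrite E, Zp; ring.
    + intros t Ht. rewrite <- Ropp_mult_distr_l, E. specialize (Sl t ltac:(lra)). nra.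
    + intros t Ht. rewrite <- Ropp_mult_distr_l, E. specialize (Sr t ltac:(lra)). nra.
Qed.

End FramedCurve.

Section FramedRationalCurve.
Context (c : curve) (t0 t1 : R) (T N : R -> V3) (e : V3) (X M K : R -> R) (d : R).
Context (F : frame t0 t1 (pt c) T N e X M K d).
Context (Hc1 : forall t, t0 < t < t1 -> vder (pt c) t (r1 c t)).
Context (Hc2 : forall t, t0 < t < t1 -> vder (r1 c) t (r2 c t)).
Context (Hc3 : forall t, t0 < t < t1 -> vder (r2 c) t (r3 c t)).
Context (X' M' : R -> R).
Context (HX' : forall t, t0 < t < t1 -> derivable_pt_lim X t (X' t)).
Context (HM' : forall t, t0 < t < t1 -> derivable_pt_lim M t (M' t)).

Let FT := fr_T _ _ _ _ _ _ _ _ _ _ F.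
Let FN := fr_N _ _ _ _ _ _ _ _ _ _ F.

Lemma framed_r1 (t : R) : t0 < t < t1 -> r1 c t = vscale (X t) (T t).
Proof.
  intros Ht. apply (vder_unique (pt c) t); [apply Hc1, Ht|].
  apply (fr_r _ _ _ _ _ _ _ _ _ _ F); lra.
Qed.

Lemma vder_interior_eq (f g : R -> V3) (t : R) (l : V3) : t0 < t < t1 ->
  (forall s, t0 < s < t1 -> f s = g s) -> vder f t l -> vder g t l.
Proof.
  intros Ht H. apply (vder_locally_eq f g t (Rmin (t - t0) (t1 - t))).
  - apply Rmin_glb_lt; lra.
  - intros s Hs. pose proof (Rmin_l (t - t0) (t1 - t)). pose proof (Rmin_r (t - t0) (t1 - t)).
    apply H; lra.
Qed.

Lemma framed_r2 (t : R) : t0 < t < t1 ->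
  r2 c t = vadd (vscale (X' t) (T t)) (vscale (X t * M t) (N t)).
Proof.
  intros Ht. apply (vder_unique (fun s => vscale (X s) (T s)) t).
  - apply (vder_interior_eq (r1 c)); [exact Ht | exact framed_r1 | apply Hc2, Ht].
  - eapply vder_eq; [apply vder_scale; [apply HX', Ht | apply FT; lra]|]. vring.
Qed.

Lemma framed_cross (t : R) : t0 < t < t1 ->
  cross (r1 c t) (r2 c t) = vscale (X t * X t * M t) (cross (T t) (N t)).
Proof. intros Ht. rewrite framed_r1, framed_r2 by exact Ht. vring. Qed.

(* Differentiate [r' x r'' = X^2 M (T x N)] and take the dot product with [r'']. *)
Lemma framed_det (t : R) : t0 < t < t1 -> det3 (r1 c t) (r2 c t) (r3 c t) <> 0.
Proof.
  intros Ht.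
  assert (E : vadd (cross (r2 c t) (r2 c t)) (cross (r1 c t) (r3 c t)) =
    vadd (vscale ((X' t * X t + X t * X' t) * M t + (X t * X t) * M' t) (cross (T t) (N t)))
      (vscale (X t * X t * M t) (vadd (cross (vscale (M t) (N t)) (N t))
         (cross (T t) (vscale (K t) e))))).
  { apply (vder_unique (fun s => vscale (X s * X s * M s) (cross (T s) (N s))) t).
    - apply (vder_interior_eq (fun s => cross (r1 c s) (r2 c s)));
        [exact Ht | exact framed_cross |].
      apply vder_cross; [apply Hc2, Ht | apply Hc3, Ht].
    - apply (vder_scale (fun s => X s * X s * M s)).
      + apply (der_mult (fun s => X s * X s)); [|apply HM', Ht].
        apply der_mult; apply HX', Ht.
      + apply vder_cross; [apply FT | apply FN]; lra. }
  apply (f_equal (fun u => dot u (r2 c t))) in E.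
  assert (E' : det3 (r1 c t) (r2 c t) (r3 c t) =
    (X t * X t * M t) * (K t * (X t * M t)) * det3 (T t) (N t) e).
  { transitivity (- dot (vadd (cross (r2 c t) (r2 c t)) (cross (r1 c t) (r3 c t))) (r2 c t)).
    - vring.
    - rewrite E, framed_r2 by exact Ht. vring. }
  rewrite E'. pose proof (fr_d _ _ _ _ _ _ _ _ _ _ F t ltac:(lra)) as Hd.
  pose proof (fr_X _ _ _ _ _ _ _ _ _ _ F t Ht). pose proof (fr_M _ _ _ _ _ _ _ _ _ _ F t Ht).
  pose proof (fr_K _ _ _ _ _ _ _ _ _ _ F t Ht).
  repeat apply Rmult_integral_contrapositive_currified; try lra.
  intro E0. rewrite E0 in Hd. lra.
Qed.

Lemma framed_r1_neq (t : R) : t0 < t < t1 -> r1 c t <> vzero.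
Proof.
  intros Ht E0. apply (framed_det t Ht). rewrite E0. vring.
Qed.

Lemma quasi_cubic_of_rational_frame :
  (forall t, t0 < t < t1 -> ~ singular c t) -> quasi_cubic c t0 t1.
Proof.
  intros Hs. apply (quasi_cubic_of_frame c t0 t1 T N e X M K d F); trivial.
  - exact framed_r1.
  - exact framed_cross.
  - exact framed_det.
Qed.

End FramedRationalCurve.

(** * Polynomials *)

Lemma peval_padd (p q : list R) (x : R) : peval (padd p q) x = peval p x + peval q x.
Proof.
  revert q; induction p as [|a p IH]; intros [|b q]; simpl; try ring. rewrite IH; ring.
Qed.

Lemma peval_map_mult (k : R) (p : list R) (x : R) : peval (map (Rmult k) p) x = k * peval p x.
Proof. induction p as [|a p IH]; simpl; [ring | rewrite IH; ring]. Qed.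

Lemma peval_pmul (p q : list R) (x : R) : peval (pmul p q) x = peval p x * peval q x.
Proof.
  induction p as [|a p IH]; simpl; [ring|].
  rewrite peval_padd, peval_map_mult; simpl. rewrite IH; ring.
Qed.

Lemma peval_psub (p q : list R) (x : R) : peval (psub p q) x = peval p x - peval q x.
Proof.
  unfold psub. rewrite peval_padd.
  replace (peval (map Ropp q) x) with (- peval q x); [ring|].
  induction q as [|a q IH]; simpl; [ring | rewrite <- IH; ring].
Qed.

Lemma peval_pderiv_aux_S (p : list R) (k : nat) (x : R) :
  peval (pderiv_aux p (S k)) x = peval (pderiv_aux p k) x + peval p x.
Proof.
  revert k; induction p as [|a p IH]; intros k; [simpl; ring|].
  cbn [pderiv_aux peval]. rewrite IH, S_INR. ring.
Qed.

Lemma peval_der (p : list R) (x : R) : derivable_pt_lim (peval p) x (peval (pderiv p) x).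
Proof.
  induction p as [|a p IH]; [exact (der_const 0 x)|].
  change (peval (a :: p)) with (fun s => a + s * peval p s).
  eapply der_eq.
  - apply (der_plus (fun _ => a) (fun s => s * peval p s)); [apply der_const|].
    apply (der_mult (fun s => s)); [apply derivable_pt_lim_id | exact IH].
  - simpl. rewrite peval_pderiv_aux_S.
    destruct p as [|b p]; simpl; ring.
Qed.

(** Being polynomial is a property of functions, so that frames can be built by pointwise formulas
    with no coefficient lists in sight. *)
Definition is_poly (f : R -> R) : Prop := exists p, forall x, f x = peval p x.

Lemma is_poly_peval (p : list R) : is_poly (peval p).
Proof. exists p; reflexivity. Qed.

Lemma is_poly_const (a : R) : is_poly (fun _ => a).
Proof. exists (a :: nil); intros; simpl; ring. Qed.

Lemma is_poly_plus (f g : R -> R) : is_poly f -> is_poly g -> is_poly (fun x => f x + g x).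
Proof. intros (p & Hp) (q & Hq); exists (padd p q); intros; rewrite peval_padd, Hp, Hq; ring. Qed.

Lemma is_poly_minus (f g : R -> R) : is_poly f -> is_poly g -> is_poly (fun x => f x - g x).
Proof. intros (p & Hp) (q & Hq); exists (psub p q); intros; rewrite peval_psub, Hp, Hq; ring. Qed.

Lemma is_poly_mult (f g : R -> R) : is_poly f -> is_poly g -> is_poly (fun x => f x * g x).
Proof. intros (p & Hp) (q & Hq); exists (pmul p q); intros; rewrite peval_pmul, Hp, Hq; ring. Qed.

Lemma is_poly_pow (s : R) (n : nat) : is_poly (fun x => (x - s) ^ n).
Proof.
  induction n as [|n IH]; [exact (is_poly_const 1)|].
  simpl. apply (is_poly_mult (fun x => x - s)); [|exact IH].
  exists (- s :: 1 :: nil); intros; simpl; ring.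
Qed.

Lemma is_poly_der (f : R -> R) : is_poly f ->
  exists f', is_poly f' /\ forall x, derivable_pt_lim f x (f' x).
Proof.
  intros (p & Hp). exists (peval (pderiv p)); split; [apply is_poly_peval|].
  intros x. apply (derivable_pt_lim_ext (peval p)); [intros; symmetry; apply Hp | apply peval_der].
Qed.

Definition vpoly (f : R -> V3) : Prop :=
  is_poly (fun x => vx (f x)) /\ is_poly (fun x => vy (f x)) /\ is_poly (fun x => vz (f x)).

Lemma vpoly_const (u : V3) : vpoly (fun _ => u).
Proof. repeat split; apply is_poly_const. Qed.

Lemma vpoly_scale (k : R -> R) (f : R -> V3) :
  is_poly k -> vpoly f -> vpoly (fun x => vscale (k x) (f x)).
Proof. intros ? (? & ? & ?); repeat split; simpl; apply is_poly_mult; assumption. Qed.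

Lemma vpoly_sub (f g : R -> V3) : vpoly f -> vpoly g -> vpoly (fun x => vsub (f x) (g x)).
Proof. intros (? & ? & ?) (? & ? & ?); repeat split; simpl; apply is_poly_minus; assumption. Qed.

Lemma is_poly_dot (f g : R -> V3) : vpoly f -> vpoly g -> is_poly (fun x => dot (f x) (g x)).
Proof.
  intros (? & ? & ?) (? & ? & ?). unfold dot.
  apply (is_poly_plus (fun x => vx (f x) * vx (g x) + vy (f x) * vy (g x)));
    [apply (is_poly_plus (fun x => vx (f x) * vx (g x)))|]; apply is_poly_mult; assumption.
Qed.

Lemma vpoly_der (f : R -> V3) : vpoly f -> exists f', vpoly f' /\ forall x, vder f x (f' x).
Proof.
  intros (Hx & Hy & Hz).
  destruct (is_poly_der _ Hx) as (x' & ? & ?). destruct (is_poly_der _ Hy) as (y' & ? & ?).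
  destruct (is_poly_der _ Hz) as (z' & ? & ?).
  exists (fun t => mkV (x' t) (y' t) (z' t)). repeat split; simpl; auto.
Qed.

(** Synthetic division by [x - s]; the length bound drives the induction in [vpoly_order]. *)
Lemma peval_divide (p : list R) (s : R) :
  exists q, (length q <= pred (length p))%nat /\
    forall x, peval p x = peval p s + (x - s) * peval q x.
Proof.
  induction p as [|a p (q & Hl & Hq)]; [exists nil; simpl; split; [lia | intros; ring]|].
  destruct p as [|b p].
  - exists nil; simpl; split; [lia | intros; ring].
  - exists (peval (b :: p) s :: q). split; [simpl in *; lia|].
    intros x. change (a + x * peval (b :: p) x =
      a + s * peval (b :: p) s + (x - s) * (peval (b :: p) s + x * peval q x)).
    rewrite (Hq x). ring.
Qed.

(** A common zero at [s] is divided out of the three coordinates simultaneously. Each division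
    shortens the lists, so the process ends with a nonzero value at [s] or with three empty
    lists. *)
Lemma vpoly_order (f : R -> V3) (s : R) : vpoly f ->
  (forall x, f x = vzero) \/
  exists n g, vpoly g /\ g s <> vzero /\ forall x, f x = vscale ((x - s) ^ n) (g x).
Proof.
  intros ((p & Hp) & (q & Hq) & (u & Hu)).
  assert (G : forall m p q u, (length p <= m)%nat -> (length q <= m)%nat -> (length u <= m)%nat ->
    let f x := mkV (peval p x) (peval q x) (peval u x) in
    (forall x, f x = vzero) \/
    exists n g, vpoly g /\ g s <> vzero /\ forall x, f x = vscale ((x - s) ^ n) (g x)).
  { clear. induction m as [|m IH]; intros p q u Lp Lq Lu f.
    - left. destruct p, q, u; simpl in *; try lia. reflexivity.
    - assert (Dec : f s = vzero \/ f s <> vzero).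
      { unfold f, vzero. destruct (Req_dec (peval p s) 0) as [->|H];
          [destruct (Req_dec (peval q s) 0) as [->|H];
            [destruct (Req_dec (peval u s) 0) as [->|H]|]|];
          [left; reflexivity | right; intro E; injection E; intros; contradiction ..]. }
      destruct Dec as [Z|Z].
      + destruct (peval_divide p s) as (p' & ? & Hp). destruct (peval_divide q s) as (q' & ? & Hq).
        destruct (peval_divide u s) as (u' & ? & Hu).
        unfold f, vzero in Z. injection Z as Zp Zq Zu. rewrite Zp in Hp. rewrite Zq in Hq. rewrite Zu in Hu.
        assert (E : forall x, f x = vscale (x - s) (mkV (peval p' x) (peval q' x) (peval u' x))).
        { intros x. unfold f. rewrite Hp, Hq, Hu. apply V3_ext; simpl; ring. }
        destruct (IH p' q' u') as [Z'|(n & g & Pg & Ng & Hg)]; try lia.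
        * left. intros x. rewrite E, Z'. vring.
        * right. exists (S n), g. repeat split; try apply Pg; trivial.
          intros x. rewrite E, Hg. simpl pow. vring.
      + right. exists 0%nat, f. repeat split; try (apply is_poly_peval); trivial.
        intros x. simpl. vring. }
  destruct (G (length p + length q + length u)%nat p q u) as [Z|(n & g & Pg & Ng & Hg)]; try lia.
  - left. intros x. rewrite <- (Z x). apply V3_ext; auto.
  - right. exists n, g. repeat split; try apply Pg; trivial.
    intros x. rewrite <- Hg. apply V3_ext; auto.
Qed.

Lemma is_poly_order (f : R -> R) (s : R) : is_poly f ->
  (forall x, f x = 0) \/
  exists n g, is_poly g /\ g s <> 0 /\ forall x, f x = (x - s) ^ n * g x.
Proof.
  (* The scalar case repeats the polynomial in all three coordinates and keeps one that is nonzero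
     at [s]. *)
  intros Hf. destruct (vpoly_order (fun x => mkV (f x) (f x) (f x)) s) as [Z|(n & g & Pg & Ng & Hg)].
  - repeat split; exact Hf.
  - left. intros x. exact (f_equal vx (Z x)).
  - right. destruct Pg as (Px & Py & Pz).
    destruct (Req_dec (vx (g s)) 0) as [Zx|];
      [destruct (Req_dec (vy (g s)) 0) as [Zy|]; [destruct (Req_dec (vz (g s)) 0) as [Zz|]|]|].
    + exfalso. apply Ng. apply V3_ext; assumption.
    + exists n, (fun x => vz (g x)). repeat split; trivial. intros x. exact (f_equal vz (Hg x)).
    + exists n, (fun x => vy (g x)). repeat split; trivial. intros x. exact (f_equal vy (Hg x)).
    + exists n, (fun x => vx (g x)). repeat split; trivial. intros x. exact (f_equal vx (Hg x)).
Qed.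

(** * Behaviour on a right neighbourhood *)

(** The point [s] is included because the frame must exist there; what can fail at [s] is stated
    under the premise [s < t]. *)
Definition near_right (s : R) (P : R -> Prop) : Prop :=
  exists b, s < b /\ forall t, s <= t <= b -> P t.

Lemma near_right_and (s : R) (P Q : R -> Prop) :
  near_right s P -> near_right s Q -> near_right s (fun t => P t /\ Q t).
Proof.
  intros (b1 & ? & H1) (b2 & ? & H2). exists (Rmin b1 b2).
  pose proof (Rmin_l b1 b2). pose proof (Rmin_r b1 b2).
  split; [apply Rmin_glb_lt; assumption|]. intros t Ht; split; [apply H1 | apply H2]; lra.
Qed.

Lemma near_right_impl (s : R) (P Q : R -> Prop) :
  (forall t, s <= t -> P t -> Q t) -> near_right s P -> near_right s Q.
Proof. intros H (b & Hb & HP). exists b; split; [exact Hb|]. intros; apply H; [lra | auto]. Qed.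

Lemma poly_pos_near (f : R -> R) (s : R) : is_poly f -> 0 < f s -> near_right s (fun t => 0 < f t).
Proof.
  intros Hf H0. destruct (is_poly_der f Hf) as (f' & _ & Df).
  assert (Hc : continuity_pt f s) by (apply derivable_continuous_pt; exists (f' s); apply Df).
  destruct (Hc (f s) H0) as (del & Hd & H). exists (s + del / 2). split; [lra|].
  intros t Ht. destruct (Req_dec t s) as [->|Hne]; [exact H0|].
  assert (G : Rabs (f t - f s) < f s).
  { apply H. repeat split; [auto|].
    simpl. unfold Rdist. rewrite Rabs_pos_eq; lra. }
  apply Rabs_def2 in G. lra.
Qed.

(** To the right of [s] the factor [(t - s) ^ n] is positive, so the sign is that of the cofactor at
    [s]. The sign is returned as [k] with [k * k = 1]. *)
Lemma poly_sign_near (f : R -> R) (s : R) : is_poly f ->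
  (forall x, f x = 0) \/
  exists k, k * k = 1 /\ near_right s (fun t => s < t -> 0 < k * f t).
Proof.
  intros Hf. destruct (is_poly_order f s Hf) as [Z|(n & g & Pg & Ng & Hg)]; [left; exact Z|right].
  assert (Hk : exists k, k * k = 1 /\ 0 < k * g s).
  { destruct (Rlt_le_dec 0 (g s)); [exists 1 | exists (-1)]; split; lra. }
  destruct Hk as (k & Hk & Hp). exists k. split; [exact Hk|].
  assert (Pkg : is_poly (fun x => k * g x)) by (apply (is_poly_mult (fun _ => k)); [apply is_poly_const | exact Pg]).
  apply (near_right_impl s (fun t => 0 < k * g t)); [|apply poly_pos_near; assumption].
  intros t _ Ht Hst. rewrite Hg. assert (0 < (t - s) ^ n) by (apply pow_lt; lra). nra.
Qed.

Lemma poly_zero_near (f : R -> R) (s : R) : is_poly f ->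
  near_right s (fun t => s < t -> f t = 0) -> forall x, f x = 0.
Proof.
  intros Hf Hz. destruct (poly_sign_near f s Hf) as [Z|(k & Hk & Hs)]; [exact Z|].
  destruct (near_right_and _ _ _ Hz Hs) as (b & Hb & H).
  destruct (H b ltac:(lra)) as (H1 & H2). specialize (H1 Hb). specialize (H2 Hb).
  rewrite H1 in H2. lra.
Qed.

(** * Derivatives of quotients and rational curves; orthogonal directions *)

Lemma vder_quot (f : R -> V3) (k : R -> R) (t k' : R) (l : V3) :
  vder f t l -> derivable_pt_lim k t k' -> k t <> 0 ->
  vder (fun s => vscale (/ k s) (f s)) t
    (vscale (/ (k t * k t)) (vsub (vscale (k t) l) (vscale k' (f t)))).
Proof.
  intros Hf Hk H0.
  assert (Hi : derivable_pt_lim (fun s => / k s) t (- k' / (k t * k t))).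
  { apply (derivable_pt_lim_ext (fun s => 1 / k s)); [intros; unfold Rdiv; ring|].
    eapply der_eq; [apply (der_div (fun _ => 1)); [apply der_const | exact Hk | exact H0]|].
    f_equal; ring. }
  eapply vder_eq; [apply (vder_scale (fun s => / k s)); [exact Hi | exact Hf]|].
  apply V3_ext; simpl; field; exact H0.
Qed.

Lemma reval_der (f : ratf) (t : R) : peval (den f) t <> 0 ->
  derivable_pt_lim (reval f) t (reval (rderiv f) t).
Proof.
  intros H. eapply der_eq.
  - apply (der_div (peval (num f)) (peval (den f))); [apply peval_der | apply peval_der | exact H].
  - unfold reval, rderiv; simpl. rewrite peval_psub, !peval_pmul. reflexivity.
Qed.

Lemma dens_nonzero_d1 (c : curve) (t : R) : dens_nonzero c t -> dens_nonzero (d1 c) t.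
Proof.
  intros (? & ? & ?); repeat split; simpl; rewrite peval_pmul;
    apply Rmult_integral_contrapositive; split; assumption.
Qed.

Lemma vder_pt (c : curve) (t : R) : dens_nonzero c t -> vder (pt c) t (pt (d1 c) t).
Proof. intros (? & ? & ?); repeat split; apply reval_der; assumption. Qed.

Lemma perp_exists (u : V3) : exists l, l <> vzero /\ dot l u = 0.
Proof.
  destruct u as [a b c]. destruct (Req_dec a 0) as [->|Ha].
  - exists (mkV 1 0 0). split; [intro E; injection E; lra | unfold dot; simpl; ring].
  - exists (mkV (- b) a 0). split; [intro E; injection E; lra | unfold dot; simpl; ring].
Qed.

(** A vector orthogonal to [w] and [w2] is proportional to their cross product; the triple product
    expansion gives this in a form without division. *)
Lemma along_cross (w w2 y : V3) : dot w y = 0 -> dot w2 y = 0 ->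
  vscale (dot (cross w w2) (cross w w2)) y = vscale (dot (cross w w2) y) (cross w w2).
Proof.
  intros H1 H2.
  transitivity (vadd (vscale (dot (cross w w2) y) (cross w w2))
    (cross (cross w w2) (vsub (vscale (dot w2 y) w) (vscale (dot w y) w2)))); [vring|].
  rewrite H1, H2. vring.
Qed.

(** * Existence of a frame *)

Lemma dot_const_der (l : V3) (f : R -> V3) (t : R) (a : V3) :
  vder f t a -> derivable_pt_lim (fun s => dot l (f s)) t (dot l a).
Proof.
  intros H. eapply der_eq; [apply der_dot; [apply vder_const | exact H]|]. vring.
Qed.

Lemma zero_of_der_near (f : R -> R) (s : R) :
  f s = 0 -> near_right s (fun t => derivable_pt_lim f t 0) -> near_right s (fun t => f t = 0).
Proof.
  intros H0 (b & Hb & H). exists b; split; [exact Hb|].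
  intros t Ht. rewrite <- H0. symmetry. apply const_of_der; [lra|]. intros; apply H; lra.
Qed.

(* [T], [N] are [B / (w . B)] and [C / (w2 . C)], where [A = (t - s)^n1 B], [T'] is a multiple of
   [(t - s)^n2 C], and [w], [w2] are the values of [B], [C] at [s]; then [w . T = 1] and
   [w . N = 0, w2 . N = 1], so [N'] is always a multiple of [w x w2]. *)
Lemma frame_of_germ (r A : R -> V3) (D : R -> R) (s : R) :
  vpoly A -> is_poly D -> near_right s (fun t => 0 < D t) ->
  near_right s (fun t => vder r t (vscale (/ D t) (A t))) ->
  (forall l, l <> vzero -> ~ forall x, dot l (A x) = 0) ->
  exists T N e X M K d X' M', near_right s (fun t1 => s < t1 ->
    frame s t1 r T N e X M K d /\
    forall t, s < t < t1 -> derivable_pt_lim X t (X' t) /\ derivable_pt_lim M t (M' t)).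
Proof.
  intros PA PD HD Hr Hind.
  destruct (vpoly_order A s PA) as [Z|(n1 & B & PB & NB & EA)].
  { exfalso. apply (Hind (mkV 1 0 0)).
    - intro E. injection E. lra.
    - intros x. rewrite Z. vring. }
  assert (HindB : forall l, l <> vzero -> ~ near_right s (fun t => dot l (B t) = 0)).
  { intros l Hl H. apply (Hind l Hl). apply (poly_zero_near _ s).
    - apply is_poly_dot; [apply vpoly_const | exact PA].
    - revert H. apply near_right_impl. intros t _ Ht _. rewrite EA.
      replace (dot l (vscale ((t - s) ^ n1) (B t))) with ((t - s) ^ n1 * dot l (B t)) by vring.
      rewrite Ht; ring. }
  destruct (vpoly_der B PB) as (B' & PB' & DB).
  set (w := B s) in *. set (b t := dot w (B t)). set (b' t := dot w (B' t)).
  assert (Pb : is_poly b) by (apply is_poly_dot; [apply vpoly_const | exact PB]).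
  assert (Pb' : is_poly b') by (apply is_poly_dot; [apply vpoly_const | exact PB']).
  assert (Db : forall t, derivable_pt_lim b t (b' t)) by (intros t; apply dot_const_der, DB).
  assert (b0 : 0 < b s) by (apply dot_self_pos, NB).
  pose proof (poly_pos_near b s Pb b0) as Hb.
  set (E1 t := vsub (vscale (b t) (B' t)) (vscale (b' t) (B t))).
  assert (PE1 : vpoly E1) by (apply vpoly_sub; apply vpoly_scale; assumption).
  set (T t := vscale (/ b t) (B t)).
  assert (DT : forall t, 0 < b t -> vder T t (vscale (/ (b t * b t)) (E1 t))).
  { intros t Ht. apply vder_quot; [apply DB | apply Db | lra]. }
  destruct (vpoly_order E1 s PE1) as [Z|(n2 & C & PC & NC & EC)].
  (* If [E1] vanished, [T] would be constant near [s], and any [l] orthogonal to [w] would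
     annihilate [B], against non-planarity. *)
  { exfalso. destruct (perp_exists w) as (l & Hl & Hlw). apply (HindB l Hl).
    assert (H : near_right s (fun t => dot l (T t) = 0)).
    { apply zero_of_der_near.
      - unfold T. fold w. transitivity (/ b s * dot l w); [vring | rewrite Hlw; ring].
      - revert Hb. apply near_right_impl. intros t _ Ht.
        eapply der_eq; [apply dot_const_der, DT, Ht|]. rewrite Z. vring. }
    generalize (near_right_and _ _ _ H Hb). apply near_right_impl. intros t _ (Ht & Hbt).
    replace (dot l (B t)) with (b t * dot l (T t)); [rewrite Ht; ring|].
    transitivity (dot l (vscale (b t * / b t) (B t))); [unfold T; generalize (/ b t) (b t); vring|].
    rewrite Rinv_r by lra. vring. }
  destruct (vpoly_der C PC) as (C' & PC' & DC).
  set (w2 := C s) in *. set (c t := dot w2 (C t)). set (c' t := dot w2 (C' t)).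
  assert (Pc : is_poly c) by (apply is_poly_dot; [apply vpoly_const | exact PC]).
  assert (Pc' : is_poly c') by (apply is_poly_dot; [apply vpoly_const | exact PC']).
  assert (Dc : forall t, derivable_pt_lim c t (c' t)) by (intros t; apply dot_const_der, DC).
  assert (c0 : 0 < c s) by (apply dot_self_pos, NC).
  pose proof (poly_pos_near c s Pc c0) as Hc.
  (* [w . T] is constant by the choice of the divisor [b], so [w] annihilates [E1], and after
     cancelling the power of [t - s] also [C]. *)
  assert (wC : forall t, dot w (C t) = 0).
  { apply (poly_zero_near _ s); [apply is_poly_dot; [apply vpoly_const | exact PC]|].
    exists (s + 1). split; [lra|]. intros t _ Hst.
    assert (E : (t - s) ^ n2 * dot w (C t) = 0).
    { transitivity (dot w (E1 t)); [rewrite EC; vring|].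
      transitivity (b t * dot w (B' t) - b' t * dot w (B t)).
      - unfold E1. generalize (b t) (b' t). vring.
      - unfold b, b'. ring. }
    apply Rmult_integral in E as [E|E]; [|exact E].
    exfalso. revert E. apply pow_nonzero. lra. }
  assert (wC' : forall t, dot w (C' t) = 0).
  { intros t. apply (uniqueness_limite (fun s => dot w (C s)) t).
    - apply dot_const_der, DC.
    - apply (derivable_pt_lim_ext (fun _ => 0)); [intros; symmetry; apply wC | apply der_const]. }
  set (E2 t := vsub (vscale (c t) (C' t)) (vscale (c' t) (C t))).
  assert (PE2 : vpoly E2) by (apply vpoly_sub; apply vpoly_scale; assumption).
  set (N t := vscale (/ c t) (C t)).
  assert (DN : forall t, 0 < c t -> vder N t (vscale (/ (c t * c t)) (E2 t))).
  { intros t Ht. apply vder_quot; [apply DC | apply Dc | lra]. }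
  set (e0 := cross w w2). set (q := dot e0 e0).
  assert (Hq : 0 < q).
  { replace q with (dot w w * dot w2 w2 - dot w w2 * dot w w2) by (unfold q, e0; vring).
    replace (dot w w2) with 0 by (symmetry; apply wC).
    assert (0 < dot w w * dot w2 w2) by (apply Rmult_lt_0_compat; apply dot_self_pos; assumption).
    lra. }
  assert (Ne0 : e0 <> vzero).
  { intro E. unfold q in Hq. rewrite E in Hq. replace (dot vzero vzero) with 0 in Hq by vring. lra. }
  assert (wE2 : forall t, dot w (E2 t) = 0).
  { intros t. transitivity (c t * dot w (C' t) - c' t * dot w (C t)).
    - unfold E2. generalize (c t) (c' t). vring.
    - rewrite wC, wC'. ring. }
  assert (w2E2 : forall t, dot w2 (E2 t) = 0).
  { intros t. transitivity (c t * dot w2 (C' t) - c' t * dot w2 (C t)).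
    - unfold E2. generalize (c t) (c' t). vring.
    - unfold c, c'. ring. }
  assert (M_def : forall t, 0 < b t -> 0 < c t ->
    vscale (/ (b t * b t)) (E1 t) = vscale ((t - s) ^ n2 * c t / (b t * b t)) (N t)).
  { intros t Hbt Hct. rewrite EC. unfold N. apply V3_ext; simpl; field; lra. }
  destruct (poly_sign_near (fun t => dot e0 (E2 t)) s) as [Z|(k & Hk & Hsign)].
  { apply is_poly_dot; [apply vpoly_const | exact PE2]. }
  (* If [e0] annihilated [E2], then [e0 . N] and [e0 . T] would keep their value 0 from [s], and [B]
     would lie in the plane orthogonal to [e0]. *)
  { exfalso. apply (HindB e0 Ne0).
    assert (HN : near_right s (fun t => dot e0 (N t) = 0)).
    { apply zero_of_der_near.
      - unfold N. fold w2. unfold e0. vring.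
      - revert Hc. apply near_right_impl. intros t _ Ht.
        eapply der_eq; [apply dot_const_der, DN, Ht|].
        transitivity (/ (c t * c t) * dot e0 (E2 t)); [generalize (/ (c t * c t)) (E2 t); vring|].
        rewrite Z; ring. }
    assert (H : near_right s (fun t => dot e0 (T t) = 0)).
    { apply zero_of_der_near.
      - unfold T. fold w. unfold e0. vring.
      - generalize (near_right_and _ _ _ HN (near_right_and _ _ _ Hb Hc)).
        apply near_right_impl. intros t _ (HNt & Hbt & Hct).
        eapply der_eq; [apply dot_const_der, DT, Hbt|]. rewrite M_def by assumption.
        transitivity ((t - s) ^ n2 * c t / (b t * b t) * dot e0 (N t));
          [generalize ((t - s) ^ n2 * c t / (b t * b t)) (N t); vring|].
        rewrite HNt; ring. }
    generalize (near_right_and _ _ _ H Hb). apply near_right_impl. intros t _ (Ht & Hbt).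
    replace (dot e0 (B t)) with (b t * dot e0 (T t)); [rewrite Ht; ring|].
    transitivity (dot e0 (vscale (b t * / b t) (B t))); [unfold T; generalize (/ b t) (b t); vring|].
    rewrite Rinv_r by lra. vring. }
  destruct (is_poly_der (fun t => (t - s) ^ n1 * b t)) as (x' & _ & Dx).
  { apply is_poly_mult; [apply is_poly_pow | exact Pb]. }
  destruct (is_poly_der (fun t => (t - s) ^ n2 * c t)) as (m' & _ & Dm).
  { apply is_poly_mult; [apply is_poly_pow | exact Pc]. }
  destruct (is_poly_der D PD) as (D' & _ & DD).
  (* The sign [k] of [e0 . E2] is put both into the constant vector and into [d]: the former makes
     [K] positive, and in the determinant condition the two factors multiply to 1. *)
  exists T, N, (vscale k e0), (fun t => (t - s) ^ n1 * b t / D t),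
    (fun t => (t - s) ^ n2 * c t / (b t * b t)), (fun t => k * dot e0 (E2 t) / (c t * c t * q)), k,
    (fun t => (x' t * D t - (t - s) ^ n1 * b t * D' t) / (D t * D t)),
    (fun t => (m' t * (b t * b t) - (t - s) ^ n2 * c t * (b' t * b t + b t * b' t)) /
              (b t * b t * (b t * b t))).
  generalize (near_right_and _ _ _ (near_right_and _ _ _ HD Hr)
    (near_right_and _ _ _ Hsign (near_right_and _ _ _ Hb Hc))).
  intros (t2 & Ht2 & H). exists t2. split; [exact Ht2|]. intros t1 Ht1 Hst.
  assert (H' : forall t, s <= t <= t1 ->
    0 < D t /\ vder r t (vscale (/ D t) (A t)) /\ (s < t -> 0 < k * dot e0 (E2 t)) /\
    0 < b t /\ 0 < c t).
  { intros t Ht. destruct (H t ltac:(lra)) as ((? & ?) & ? & ? & ?). auto. }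
  clear H. split; [constructor|].
  - exact Hst.
  - intros t Ht. destruct (H' t Ht) as (HDt & Hrt & _ & Hbt & _).
    eapply vder_eq; [exact Hrt|]. rewrite EA. unfold T. apply V3_ext; simpl; field; lra.
  - intros t Ht. destruct (H' t Ht) as (_ & _ & _ & Hbt & Hct).
    eapply vder_eq; [apply DT, Hbt|]. apply M_def; assumption.
  - intros t Ht. destruct (H' t Ht) as (_ & _ & _ & _ & Hct).
    eapply vder_eq; [apply DN, Hct|].
    pose proof (along_cross w w2 (E2 t) (wE2 t) (w2E2 t)) as E. fold e0 in E. fold q in E.
    transitivity (vscale (/ (c t * c t * q)) (vscale q (E2 t))).
    + generalize (E2 t). intros y. apply V3_ext; simpl; field; lra.
    + rewrite E.
      transitivity (vscale ((k * k) * dot e0 (E2 t) / (c t * c t * q)) e0).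
      * rewrite Hk. apply V3_ext; simpl; field; lra.
      * apply V3_ext; simpl; field; lra.
  - intros t Ht. destruct (H' t ltac:(lra)) as (HDt & _ & _ & Hbt & _).
    apply Rdiv_lt_0_compat; [|exact HDt]. apply Rmult_lt_0_compat; [apply pow_lt; lra | exact Hbt].
  - intros t Ht. destruct (H' t ltac:(lra)) as (_ & _ & _ & Hbt & Hct).
    apply Rdiv_lt_0_compat; apply Rmult_lt_0_compat; trivial. apply pow_lt; lra.
  - intros t Ht. destruct (H' t ltac:(lra)) as (_ & _ & Hs & _ & Hct).
    apply Rdiv_lt_0_compat; [apply Hs; lra|]. repeat apply Rmult_lt_0_compat; assumption.
  - intros t Ht. destruct (H' t Ht) as (_ & _ & _ & Hbt & Hct).
    transitivity (k * k * (/ b t * / c t) * dot (cross (B t) (C t)) e0).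
    + unfold T, N. generalize (/ b t) (/ c t). vring.
    (* Lagrange's identity; the mixed product drops out by [wC]. *)
    + replace (dot (cross (B t) (C t)) e0) with (b t * c t - dot w2 (B t) * dot w (C t))
        by (unfold b, c, e0; vring).
      rewrite wC, Hk. field; lra.
  - intros t Ht. destruct (H' t ltac:(lra)) as (HDt & _ & _ & Hbt & Hct). split.
    + apply (der_div (fun t => (t - s) ^ n1 * b t)); [apply Dx | apply DD | lra].
    + apply (der_div (fun t => (t - s) ^ n2 * c t) (fun t => b t * b t));
        [apply Dm | apply der_mult; apply Db | apply Rmult_integral_contrapositive_currified; lra].
Qed.

(** * Exclusion of singular points and conclusion *)

(** Meant for the exceptional set in [proper]. That set may contain [s] itself, hence the premise
    [s < t]. *)
Lemma avoid_finite (E : list C) (s : R) : near_right s (fun t => s < t -> ~ In (RtoC t) E).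
Proof.
  induction E as [|z E IH]; [exists (s + 1); split; [lra | intros t _ _ []]|].
  assert (H : near_right s (fun t => s < t -> z <> RtoC t)).
  { destruct (Rlt_le_dec s (fst z)) as [L|L].
    - exists ((s + fst z) / 2). split; [lra|]. intros t Ht _ ->. simpl in L, Ht. lra.
    - exists (s + 1). split; [lra|]. intros t Ht Hst ->. simpl in L. lra. }
  generalize (near_right_and _ _ _ IH H). apply near_right_impl.
  intros t _ (H1 & H2) Hst [E'|E']; [exact (H2 Hst E') | exact (H1 Hst E')].
Qed.

Lemma pevalC_real (p : list R) (t : R) : pevalC p (RtoC t) = RtoC (peval p t).
Proof.
  induction p as [|a p IH]; [reflexivity|]. simpl. rewrite IH. unfold Cadd, Cmul, RtoC; simpl.
  f_equal; ring.
Qed.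

Lemma dens_nonzeroC_real (c : curve) (t : R) : dens_nonzero c t -> dens_nonzeroC c (RtoC t).
Proof.
  intros (H1 & H2 & H3). repeat split; rewrite pevalC_real; intro E;
    apply (f_equal fst) in E; simpl in E; contradiction.
Qed.

Theorem theorem1 (c : curve) (I : R -> Prop) (t0 : R) :
  is_interval I ->
  (forall t, I t -> dens_nonzero c t) ->
  proper c ->
  nonplanar c I ->
  I t0 ->
  (exists t, I t /\ t0 < t) ->
  exists t1, I t1 /\ t0 < t1 /\ quasi_cubic c t0 t1.
Proof.
  intros HI Hden (E & HE) Hnp H0 (tb & Htb & Hlt).
  set (dx := peval (den (cx c))). set (dy := peval (den (cy c))). set (dz := peval (den (cz c))).
  set (A t := mkV (peval (num (rderiv (cx c))) t * ((dy t * dz t) * (dy t * dz t)))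
                  (peval (num (rderiv (cy c))) t * ((dx t * dz t) * (dx t * dz t)))
                  (peval (num (rderiv (cz c))) t * ((dx t * dy t) * (dx t * dy t)))).
  (* [r' = A / D] with the square of the common denominator as [D], so that [D] is positive on all
     of [I]. *)
  set (D t := (dx t * dy t * dz t) * (dx t * dy t * dz t)).
  assert (PA : vpoly A).
  { repeat split; simpl; repeat apply is_poly_mult; apply is_poly_peval. }
  assert (PD : is_poly D) by (repeat apply is_poly_mult; apply is_poly_peval).
  assert (Dnz : forall t, I t -> dx t <> 0 /\ dy t <> 0 /\ dz t <> 0).
  { intros t Ht. exact (Hden t Ht). }
  assert (Dpos : forall t, I t -> 0 < D t).
  { intros t Ht. destruct (Dnz t Ht) as (? & ? & ?). unfold D.
    apply Rsqr_pos_lt. repeat apply Rmult_integral_contrapositive_currified; assumption. }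
  assert (Er1 : forall t, I t -> r1 c t = vscale (/ D t) (A t)).
  { intros t Ht. destruct (Dnz t Ht) as (? & ? & ?).
    assert (Ed : forall f, peval (den (rderiv f)) t = peval (den f) t * peval (den f) t)
      by (intros f; simpl; apply peval_pmul).
    unfold r1, d1, cmap, pt, A, D; simpl cx; simpl cy; simpl cz. unfold reval.
    rewrite !Ed. fold dx dy dz. apply V3_ext; simpl; field; repeat split; assumption. }
  assert (Dr : forall t, I t -> vder (pt c) t (vscale (/ D t) (A t))).
  { intros t Ht. rewrite <- Er1 by exact Ht. apply vder_pt, Hden, Ht. }
  assert (Near : near_right t0 I).
  { exists tb. split; [exact Hlt|]. intros t Ht. apply (HI t0 tb); assumption. }
  destruct (frame_of_germ (pt c) A D t0 PA PD) as (T & N & e & X & M & K & d & X' & M' & HF).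
  - revert Near. apply near_right_impl. intros t _; apply Dpos.
  - revert Near. apply near_right_impl. intros t _; apply Dr.
  (* If [l] annihilated [A], then [l . r] would have derivative zero on the interval [I], and the
     curve would lie in a plane. *)
  - intros l Hl Hz. apply Hnp. exists l, (dot l (pt c t0)). split; [exact Hl|].
    assert (Cst : forall a b, I a -> I b -> a <= b -> dot l (pt c a) = dot l (pt c b)).
    { intros a b Ha Hb Hab. apply (const_of_der (fun t => dot l (pt c t))); [exact Hab|].
      intros t Ht. eapply der_eq; [apply dot_const_der, Dr, (HI a b); assumption|].
      transitivity (/ D t * dot l (A t)); [generalize (/ D t) (A t); vring | rewrite Hz; ring]. }
    intros t Ht. destruct (Rle_lt_dec t t0); [|symmetry]; apply Cst; trivial; lra.
  - destruct (near_right_and _ _ _ HF (near_right_and _ _ _ Near (avoid_finite E t0)))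
      as (t1 & Ht1 & H).
    destruct (H t1 ltac:(lra)) as (HF1 & It1 & _). destruct (HF1 Ht1) as (F & HXM).
    assert (It : forall t, t0 < t < t1 -> I t) by (intros t Ht; apply (H t); lra).
    assert (Hc1 : forall t, t0 < t < t1 -> vder (pt c) t (r1 c t)).
    { intros t Ht. apply vder_pt, Hden, It, Ht. }
    assert (Hc2 : forall t, t0 < t < t1 -> vder (r1 c) t (r2 c t)).
    { intros t Ht. apply (vder_pt (d1 c)), dens_nonzero_d1, Hden, It, Ht. }
    assert (Hc3 : forall t, t0 < t < t1 -> vder (r2 c) t (r3 c t)).
    { intros t Ht. apply (vder_pt (d1 (d1 c))), dens_nonzero_d1, dens_nonzero_d1, Hden, It, Ht. }
    assert (HX : forall t, t0 < t < t1 -> derivable_pt_lim X t (X' t)) by (intros; apply HXM; assumption).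
    assert (HM : forall t, t0 < t < t1 -> derivable_pt_lim M t (M' t)) by (intros; apply HXM; assumption).
    exists t1. split; [exact It1|]. split; [exact Ht1|].
    apply (quasi_cubic_of_rational_frame c t0 t1 T N e X M K d F Hc1 Hc2 Hc3 X' M' HX HM).
    (* A second parameter for the same point contradicts properness because [t] is outside [E]; a
       zero of [r'] contradicts the nonvanishing of [det3 (r1 c t) (r2 c t) (r3 c t)]. *)
    intros t Ht [(z & Hz & Hdz & Hsame)|Hr].
    + apply Hz, HE; trivial.
      * destruct (H t ltac:(lra)) as (_ & _ & HnE). apply HnE; lra.
      * apply dens_nonzeroC_real, Hden, It, Ht.
    + exact (framed_r1_neq c t0 t1 T N e X M K d F Hc1 Hc2 Hc3 X' M' HX HM t Ht Hr).
Qed.
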